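(* Let $d\ge1$ and let $\{Q_m\}_{m\in\mathbb{N}}$ be a family of laws of $m$-point strong Markov processes with components in $\mathbb{R}^d$, as described in the context, satisfying the dimension consistency property. Suppose there is a positive random variable $\zeta^*$ such that the meeting time $\overline\tau_{x,y}$ is stochastically dominated by $\zeta^*$ irrespective of $x,y\in\mathbb{R}^d$. Then: (i) There exists a positive constant $C$ such that for all $x,y\in\mathbb{R}^d$ and all $m\in\mathbb{N}$, $$P(\overline\tau_{x,y}>t)\le C\,2^{-t}\quad\text{for all } t\ge0.$$ (ii) Moreover, if there is an $\alpha>0$ such that $$\liminf_{u\to0+}\frac1u P(\zeta^*\le u)\ge\alpha$$ (for example, when $\zeta^*$ has a positive density $\alpha$ at zero), then every $\overline\tau_{x,y}$ is stochastically dominated by an exponential random variable with rate $\alpha$. (iii) The mixing time for shuffling is $O(\log m)$ as $m\to\infty$. In particular, when the condition in (ii) holds, $t_{\mathrm{mix}}(\epsilon)\le\frac1\alpha\log(m/\epsilon)$.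
   Context: Processes. For every $m\in\mathbb{N}$, on a right-continuous and complete filtered probability space there is a strong Markov process $Z^{(m)}(t)=(Z^{(m)}_1(t),\dots,Z^{(m)}_m(t))$, $t\ge0$, where each component process has state space $\mathbb{R}^d$ and paths that are right-continuous with left limits. Discrete-time Markov processes are allowed, extended to continuous time by piecewise constant interpolation. $Q_m(z_1,\dots,z_m)$ denotes the law of the process started from $(z_1,\dots,z_m)$. Dimension consistency. For any $m\in\mathbb{N}$, if $Z^{(m)}$ is distributed according to $Q_m(z_1,\dots,z_m)$, then for any $i\ne j$ the marginal distribution of the process $(Z^{(m)}_i,Z^{(m)}_j)$ is $Q_2(z_i,z_j)$. Meeting time. For $x,y\in\mathbb{R}^d$, $\overline\tau_{x,y}=\inf\{t\ge0: Z^{(m)}_i(t)=Z^{(m)}_j(t)\}$ where $i\ne j$, $Z^{(m)}_i(0)=x$, $Z^{(m)}_j(0)=y$. By dimension consistency its distribution under $Q_m(z_1,\dots,z_m)$ does not depend on $m$ or on $z_k$, $k\notin\{i,j\}$, so $m$ is dropped from the notation. A random variable $V$ is stochastically dominated by $W$ if $P(V>t)\le P(W>t)$ for all $t\in\mathbb{R}$. Mixing time of shuffling. Fix one of the $d$ coordinates and call it the $x$-coordinate; let $X^{(m)}_j(t)$ be the $x$-coordinate of $Z^{(m)}_j(t)$. For real numbers $(x_1,\dots,x_m)$, the rank-to-index permutation $\gamma$ is the permutation of $[m]=\{1,\dots,m\}$ such that $x_{\gamma_i}$ is the $i$-th smallest, ties being resolved at random: take independent i.i.d. uniform $[0,1]$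 variables $U_1,\dots,U_m$ and order the pairs $(x_i,U_i)$ lexicographically. Let $\gamma^{(m)}(t)$ be the rank-to-index permutation of $(X^{(m)}_1(t),\dots,X^{(m)}_m(t))$. For $\epsilon>0$, $t_{\mathrm{mix}}(\epsilon)$ is the first time at which the total variation distance between the law of $\gamma^{(m)}(t)$ and the uniform distribution on the permutations of $[m]$ is smaller than $\epsilon$, irrespective of the initial positions.
   Formalization: In (i) the bound is C 2^{-t/M} for every M>0 with P(ζ*>M) ≤ 1/2 (such M exists; C does not depend on M), since 2^{-t} fails in general. In (iii) the laws Q_m are also assumed exchangeable under relabelling of points, and the bound on t_mix(ε) is for ε ≤ m. *)

(* Defs.v *)
From HB Require Import structures.
From mathcomp Require Import all_boot all_order all_algebra all_fingroup.
From mathcomp Require Import all_classical all_reals all_analysis.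

Set Implicit Arguments.
Unset Strict Implicit.
Unset Printing Implicit Defensive.

Import Order.TTheory GRing.Theory Num.Theory.
Import numFieldTopology.Exports numFieldNormedType.Exports.

Local Open Scope classical_set_scope.
Local Open Scope ring_scope.

Section paths.
Context (R : realType) (m d : nat).

Definition coordinate_sets : set (set ('I_m -> 'rV[R]_d)) :=
  [set A | exists (i : 'I_m) (k : 'I_d), exists2 B : set R, measurable B &
    A = [set x : 'I_m -> 'rV[R]_d | B (x i ord0 k)]].

(* m points of R^d, with the Borel sigma-algebra of R^(m * d) *)
Definition config := g_sigma_algebraType coordinate_sets.

(* Only the nonnegative times generate events: the values of a path at
   negative times are irrelevant. *)
Definition cylinder_sets : set (set (R -> config)) :=
  [set A | exists2 t : R, 0 <= t & exists2 B : set config, measurable B &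
    A = [set w : R -> config | B (w t)]].

Definition path_space := g_sigma_algebraType cylinder_sets.

End paths.

Section filtered_spaces.
Context (R : realType).

(* filtered probability spaces satisfying the usual conditions *)
Record filtered_space := FilteredSpace {
  fs_disp : measure_display ;
  fs_sort :> measurableType fs_disp ;
  fs_prob : probability fs_sort R ;
  filt : R -> set (set fs_sort) ;
  filt_sigma_algebra : forall t, 0 <= t -> sigma_algebra [set: fs_sort] (filt t) ;
  filt_measurable : forall t, 0 <= t -> filt t `<=` measurable ;
  filt_nondecreasing : forall s t, 0 <= s -> s <= t -> filt s `<=` filt t ;
  filt_right_continuous : forall t, 0 <= t ->
    \bigcap_(s in [set s | t < s]) filt s `<=` filt t ;
  fs_complete : measure_is_complete fs_prob ;
  filt_complete : forall N, fs_prob.-negligible N -> filt 0 N }.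

Definition stopping_time (S : filtered_space) (T : S -> \bar R) :=
  (forall w, 0 <= T w)%E /\
  forall t, 0 <= t -> filt t [set w | (T w <= t%:E)%E].

(* the sigma-algebra of the stopping time T *)
Definition before (S : filtered_space) (T : S -> \bar R) : set (set S) :=
  [set E | measurable E /\
    forall t, 0 <= t -> filt t (E `&` [set w | (T w <= t%:E)%E])].

(* For a discrete-time process, interpolated to be constant on every [n, n+1),
   the Markov property is available at integer times only. *)
Definition time_set (discrete : bool) : set R :=
  if discrete then range (fun n : nat => n%:R) else [set t | 0 <= t].

Definition time_valued (discrete : bool) (S : filtered_space)
    (T : S -> \bar R) :=
  forall w, T w = +oo%E \/ exists2 t, time_set discrete t & T w = t%:E.

End filtered_spaces.

Section processes.
Context (R : realType) (d : nat).

(* A process started from z, with law Q z on path space, which is strong Markov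
   for the transition mechanism Q: given the sigma-algebra of a stopping time T,
   on {T < +oo} the path after T has law Q (Z T). *)
Record process (discrete : bool) (m : nat)
    (Q : R.-pker (config R m d) ~> (path_space R m d)) (z : config R m d) := Process {
  space : filtered_space R ;
  traj : R -> space -> config R m d ;
  traj0 : forall w, traj 0 w = z ;
  traj_right_continuous : forall (w : space) (i : 'I_m) (t : R), 0 <= t ->
    (fun s => (traj s w i : 'rV[R]_d)) @ t^'+ --> (traj t w i : 'rV[R]_d) ;
  traj_left_limits : forall (w : space) (i : 'I_m) (t : R), 0 < t ->
    cvg ((fun s => (traj s w i : 'rV[R]_d)) @ t^'-) ;
  traj_interpolated : discrete ->
    forall (w : space) (t : R), 0 <= t -> traj t w = traj (Num.truncn t)%:R w ;
  traj_adapted : forall t, 0 <= t ->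
    forall B : set (config R m d), measurable B -> filt t (traj t @^-1` B) ;
  traj_law : forall A : set (path_space R m d), measurable A ->
    fs_prob space [set w | A (traj ^~ w)] = Q z A ;
  traj_strong_Markov : forall T : space -> \bar R,
    stopping_time T -> time_valued discrete T ->
    forall E, before T E ->
    forall A : set (path_space R m d), measurable A ->
    fs_prob space (E `&` [set w | (T w < +oo)%E]
                     `&` [set w | A (fun s => traj (fine (T w) + s) w)]) =
    (\int[fs_prob space]_(w in E `&` [set w | T w < +oo])
        Q (traj (fine (T w)) w) A)%E }.

Definition prob (discrete : bool) (m : nat)
    (Q : R.-pker (config R m d) ~> (path_space R m d)) (z : config R m d)
    (Z : process discrete Q z) : probability (space Z) R := fs_prob (space Z).

Definition meeting_time (discrete : bool) (m : nat)
    (Q : R.-pker (config R m d) ~> (path_space R m d)) (z : config R m d)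
    (Z : process discrete Q z) (i j : 'I_m) (w : space Z) : \bar R :=
  ereal_inf [set t%:E | t in [set t : R | 0 <= t /\ traj t w i = traj t w j]].

Definition pair_config (x y : 'rV[R]_d) : config R 2%N d :=
  fun i => if i == ord0 then x else y.

Definition dimension_consistent
    (Q : forall m, R.-pker (config R m d) ~> (path_space R m d)) :=
  forall m (z : config R m d) (i j : 'I_m), i != j ->
  forall A : set (path_space R 2%N d), measurable A ->
    Q m z [set w | A (fun t => pair_config (w t i) (w t j))] =
    Q 2%N (pair_config (z i) (z j)) A.

(* Relabelling the points relabels the process. *)
Definition exchangeable
    (Q : forall m, R.-pker (config R m d) ~> (path_space R m d)) :=
  forall m (z : config R m d) (s : 'S_m),
  forall A : set (path_space R m d), measurable A ->
    Q m z [set w | A (fun t i => w t (s i))] = Q m (fun i => z (s i)) A.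

End processes.

Arguments meeting_time {R d discrete m Q z} Z i j w.

Definition stochastically_dominated (R : realType) (T T' : Type)
    (P : set T -> \bar R) (V : T -> \bar R)
    (P' : set T' -> \bar R) (W : T' -> \bar R) :=
  forall t : R,
    (P [set a | t%:E < V a] <= P' [set b | t%:E < W b])%E.

Section shuffling.
Context (R : realType).

(* Taking A k = setT for some of the k covers every finite subfamily. *)
Definition iid_uniform dU (TU : measurableType dU) (PU : probability TU R)
    (U : nat -> {RV PU >-> R}) :=
  (forall k (A : set R), measurable A ->
     distribution PU (U k) A = uniform_prob (@ltr01 R) A) /\
  (forall n (A : nat -> set R), (forall k, measurable (A k)) ->
     PU (\bigcap_(k in [set k | (k < n)%N]) (U k @^-1` A k)) =
     (\prod_(k < n) PU (U k @^-1` A k))%E).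

(* g lists the indices by increasing lexicographic order of the pairs
   (x i, u i); there is exactly one such g as soon as the pairs are distinct. *)
Definition rank_to_index m (x u : 'I_m -> R) (g : 'S_m) :=
  forall i j : 'I_m, (i < j)%N ->
    x (g i) < x (g j) \/ (x (g i) = x (g j) /\ u (g i) < u (g j)).

Context (d : nat) (discrete : bool).
Context (Q : forall m, R.-pker (config R m d) ~> (path_space R m d)).
Context (Z : forall m (z : config R m d), process discrete (Q m) z).
Context (dU : measure_display) (TU : measurableType dU).
Context (PU : probability TU R) (U : nat -> {RV PU >-> R}).

(* law at time t of the rank-to-index permutation of the k-th coordinates; the
   product space makes the tie-breaking variables independent of the process *)
Definition shuffle_law (k : 'I_d) m (z : config R m d) (t : R)
    (A : {set 'S_m}) : \bar R :=
  (prob (Z z) \x PU)%E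
    [set w | exists2 g, g \in A &
       rank_to_index (fun i => traj t w.1 i ord0 k) (fun i => U i w.2) g].

Definition shuffle_tv (k : 'I_d) m (z : config R m d) (t : R) : \bar R :=
  (\big[maxe/0]_(A : {set 'S_m})
     `| shuffle_law k z t A - (#|A|%:R / #|[set: 'S_m]|%:R)%:E |)%E.

Definition t_mix (k : 'I_d) (m : nat) (eps : R) : \bar R :=
  ereal_inf [set t%:E | t in [set t : R | 0 <= t /\
    forall z : config R m d, (shuffle_tv k z t < eps%:E)%E]].

End shuffling.

(* Main.v *)
Require Import Defs.
From HB Require Import structures.
From mathcomp Require Import all_boot all_order all_algebra all_fingroup.
From mathcomp Require Import all_classical all_reals all_analysis.
From mathcomp Require Import measurable_realfun ring lra.

Set Implicit Arguments.
Unset Strict Implicit.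
Unset Printing Implicit Defensive.

Import Order.TTheory GRing.Theory Num.Theory.
Import numFieldTopology.Exports numFieldNormedType.Exports.

Local Open Scope classical_set_scope.
Local Open Scope ring_scope.

(** Both halves of the theorem restart the process: at a fixed time for the tails
    of the meeting times, at the meeting time itself for the shuffle.

    Tails.  Suppose that, wherever two points start, they have not met by time u
    with probability at most c.  If they have not met by time s, restart the
    process at s: the two points are at some new positions, and the probability
    that they still do not meet for a further u is again at most c.  So the tail
    decays geometrically along the multiples of u (tail_step, tail_power).  With
    c = 1/2, at a time that the dominating variable exceeds with probability at
    most 1/2, this is the bound by powers of 2; with c = exp (- a u) and u tending
    to 0, it is the exponential bound at any rate a < alpha, hence at the rate
    alpha (tail_rate).  In discrete time the process can be restarted at integers
    only, but as distinct points do not meet before time 1, a bound with c < 1 can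
    be moved to an integer time (pair_tail_time).

    Shuffle.  When the points i and j meet, they are at the same place, so by
    exchangeability the law of what follows does not change if their labels are
    exchanged (swap_after_meeting).  Let e bound the probability that a given pair
    has not met by time t.  The law of the state at time t, and with it the law
    of the rank-to-index permutation, then changes by at most e in total variation
    under any transposition of labels (swap_bound; the tie-breaking variables are
    exchangeable as well).  A permutation is a product of at most m
    transpositions, so every translate of the law is within m * e of it, while the
    average of all translates is the uniform law (nearly_uniform).  The
    distance from uniformity is therefore at most m * e.  The law is compared with
    its own translates, instead of being coupled with that of m further points
    starting from a common position, because consistency relates only the laws of
    pairs.

    Measurability.  The meeting time is the first zero of a right-continuous
    function, and is in general neither the limit of the first times at which the
    function is small, since the function may come close to 0 and jump away, nor
    a measurable function on path space.  A form of the debut theorem (debut)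
    is thus needed twice: on the probability space of the process, to see that the
    meeting time is a stopping time (meeting_time_optional), and on path space, to
    compare meeting times of processes on different probability spaces through
    their laws (meet_minorant). *)

(** * Zeros of right-continuous real functions *)

Lemma at_right_ball (R : realType) (t : R) (P : R -> Prop) :
  (\forall s \near t^'+, P s) ->
  exists2 e : R, 0 < e & forall s, t < s -> s < t + e -> P s.
Proof.
move=> [e /= e0 eP]; exists e => // s ts ste; apply: eP => //=.
by rewrite distrC gtr0_norm ?subr_gt0// ltrBlDl.
Qed.

Definition right_continuous_from0 (R : realType) (D : R -> R) :=
  forall t, 0 <= t -> D s @[s --> t^'+] --> D t.

Definition first_zero (R : realType) (D : R -> R) : \bar R :=
  ereal_inf [set t%:E | t in [set t : R | 0 <= t /\ D t = 0]].

(** The limit, as the tolerance decreases to 0, of the infimum of the rational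
    times from x on at which D is below the tolerance.  Only countably many values
    of D enter, so that this is measurable in D, unlike the first zero itself. *)
Definition next_small (R : realType) (D : R -> R) (x : \bar R) : \bar R :=
  ereal_sup (range (fun n : nat =>
    ereal_inf [set (ratr q : R)%:E | q in [set q : rat |
      (x <= (ratr q)%:E)%E /\ D (ratr q) < n.+1%:R^-1]])).

Section first_zero.
Context (R : realType) (D : R -> R).
Hypotheses (D_ge0 : forall t, 0 <= D t) (Drc : right_continuous_from0 D).

Lemma right_continuous_close (t e : R) : 0 <= t -> 0 < e ->
  exists2 c : R, 0 < c &
    forall s, t < s -> s < t + c -> `|D t - D s| < e.
Proof.
move=> t0 e0; apply: at_right_ball.
by have /cvgrPdist_lt := Drc t0; exact.
Qed.

Lemma zero_of_small (t : R) : 0 <= t ->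
  (forall e : R, 0 < e -> exists s, [/\ t <= s, s < t + e & D s < e]) ->
  D t = 0.
Proof.
move=> t0 small; apply/eqP; rewrite eq_le D_ge0 andbT leNgt.
apply/negP => Dt0.
have Dt2 : 0 < D t / 2 by rewrite divr_gt0.
have [c c0 cP] := right_continuous_close t0 Dt2.
have m0 : 0 < Num.min c (D t / 2) by rewrite lt_min c0.
have [s [ts sc Ds]] := small _ m0.
have [Dsc DsD] : s < t + c /\ D s < D t / 2.
  by move: sc Ds; rewrite -ltrBlDl !lt_min ltrBlDl => /andP[? _] /andP[_ ?].
have [tE|] := eqVneq t s; first by rewrite -tE in DsD; lra.
move=> tNs; have {tNs}ts' : t < s by rewrite lt_neqAle tNs.
have := cP s ts' Dsc; rewrite ltr_norml => /andP[]; lra.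
Qed.

Lemma first_zero_ge0 : (0 <= first_zero D)%E.
Proof. by apply/ereal_infP => _ [t [t0 _] <-]; rewrite lee_fin. Qed.

Lemma first_zero_attained (t : R) : (first_zero D <= t%:E)%E ->
  exists s : R, [/\ 0 <= s, s <= t, first_zero D = s%:E & D s = 0].
Proof.
have := first_zero_ge0; case E : (first_zero D) => [s| |] // s0 st.
rewrite !lee_fin in s0 st; exists s; split => //.
apply: zero_of_small => // e e0.
have : (first_zero D < (s + e)%:E)%E by rewrite E lte_fin ltrDl.
move=> /ereal_inf_ltP[_ [u [u0 Du] <-]]; rewrite lte_fin => us.
exists u; split => //; last by rewrite Du.
by rewrite -lee_fin -E; apply: ereal_inf_lbound; exists u.
Qed.

(** D is small at rational times arbitrarily close after its first zero. *)
Lemma next_small_le (x : \bar R) :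
  (0 <= x)%E -> (x <= first_zero D)%E -> (next_small D x <= first_zero D)%E.
Proof.
move=> x0 xle; apply/ereal_supP => _ [n _ <-].
case: (leP +oo%E (first_zero D)) => [|fin].
  by rewrite leye_eq => /eqP ->; rewrite leey.
have [t /ltW/first_zero_attained [s [s0 _ E Ds]]] :
    exists t : R, (first_zero D < t%:E)%E.
  have := first_zero_ge0; case: (first_zero D) fin => // r _ _.
  by exists (r + 1); rewrite lte_fin ltrDl.
rewrite E; apply/lee_addgt0Pr => e e0.
have n0 : 0 < n.+1%:R^-1 :> R by rewrite invr_gt0.
have [c c0 cP] := right_continuous_close s0 n0.
have [|q] := @rat_in_itvoo R s (s + Num.min c e).
  by rewrite ltrDl lt_min c0.
rewrite in_itv/= => /andP[sq]; rewrite -ltrBlDl lt_min !ltrBlDl => /andP[qc qe].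
apply: ge_ereal_inf; exists (ratr q)%:E; last by rewrite -EFinD lee_fin ltW.
exists q => //; split; last first.
  by have := cP _ sq qc; rewrite Ds sub0r normrN ger0_norm.
by apply: (le_trans xle); rewrite E lee_fin ltW.
Qed.

Lemma le_next_small (x : \bar R) : (x <= next_small D x)%E.
Proof.
apply: le_ereal_sup_tmp.
exists (ereal_inf [set (ratr q : R)%:E | q in [set q : rat |
      (x <= (ratr q)%:E)%E /\ D (ratr q) < 0.+1%:R^-1]]); first by exists 0%N.
by apply/ereal_infP => _ [q [xq _] <-].
Qed.

(** By right-continuity, D vanishes at x if it takes arbitrarily small values at
    times arbitrarily close after x.  If D does not vanish at x, then next_small
    makes progress, possibly only up to a time at which a left limit vanishes. *)
Lemma first_zero_le_fixpoint (x : \bar R) :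
  (0 <= x)%E -> next_small D x = x -> (first_zero D <= x)%E.
Proof.
case: x => [x| |] //; last by move=> *; rewrite leey.
rewrite lee_fin => x0 fix_x; apply: ereal_inf_lbound; exists x => //; split => //.
apply: zero_of_small => // e e0.
have [n] := ltr_add_invr e0; rewrite add0r => ne.
have : (next_small D x%:E < (x + e)%:E)%E by rewrite fix_x lte_fin ltrDl.
have : (ereal_inf [set (ratr q : R)%:E | q in [set q : rat |
    (x%:E <= (ratr q)%:E)%E /\ (D (ratr q) < n.+1%:R^-1)%R]] <=
    next_small D x%:E)%E by apply: ereal_sup_ubound; exists n.
move=> /le_lt_trans/[apply]/ereal_inf_ltP[_ [q [xq Dq] <-]].
rewrite lte_fin => qe.
by exists (ratr q); split; [rewrite -lee_fin|exact: qe|exact: lt_trans ne].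
Qed.

End first_zero.

(** * The debut theorem *)

Definition right_continuous_filtration (R : realType) d (T : measurableType d)
    (G : R -> set (set T)) :=
  [/\ forall t, 0 <= t -> sigma_algebra [set: T] (G t),
      forall t, 0 <= t -> G t `<=` measurable,
      forall s t, 0 <= s -> s <= t -> G s `<=` G t &
      forall t, 0 <= t -> \bigcap_(s in [set s | t < s]) G s `<=` G t].

Definition optional_time (R : realType) (T : Type) (G : R -> set (set T))
    (S : T -> \bar R) :=
  (forall w, 0 <= S w)%E /\ forall t, 0 <= t -> G t [set w | (S w <= t%:E)%E].

Section sigma_algebra_ops.
Context (T : Type) (F : set (set T)).
Hypothesis sF : sigma_algebra [set: T] F.

Lemma sigma_set0 : F set0.
Proof. by case: sF. Qed.

Lemma sigma_setC A : F A -> F (~` A).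
Proof. by move=> FA; rewrite -setTD; case: sF => _ + _; exact. Qed.

Lemma sigma_bigcup (I : countType) (A : I -> set T) :
  (forall i, F (A i)) -> F (\bigcup_i A i).
Proof.
move=> FA; rewrite (_ : \bigcup_i A i =
    \bigcup_n if unpickle n is Some i then A i else set0).
  by have [_ _ cupF] := sF; apply: cupF => n; case: unpickle => //; exact: sigma_set0.
apply/seteqP; split=> w [i _].
  by exists (pickle i); [exact: Logic.I|rewrite pickleK].
by case: unpickle => // l Al; exists l.
Qed.

Lemma sigma_bigcap (I : countType) (A : I -> set T) :
  (forall i, F (A i)) -> F (\bigcap_i A i).
Proof.
move=> FA; rewrite -[X in F X]setCK setC_bigcap.
by apply/sigma_setC/sigma_bigcup => i; exact: sigma_setC.
Qed.

Lemma sigma_setI A B : F A -> F B -> F (A `&` B).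
Proof.
by move=> FA FB; rewrite -bigcap2E; apply: sigma_bigcap => -[|[|n]] //=;
  rewrite -setC0; apply/sigma_setC/sigma_set0.
Qed.

Lemma sigma_setU A B : F A -> F B -> F (A `|` B).
Proof.
move=> FA FB; rewrite -[A]setCK -[B]setCK -setCI.
by apply/sigma_setC/sigma_setI; exact: sigma_setC.
Qed.

End sigma_algebra_ops.

Lemma negligible_bigcup_countable (R : realType) d (T : measurableType d)
    (mu : {measure set T -> \bar R}) (I : countType) (N : I -> set T) :
  (forall i, mu.-negligible (N i)) -> mu.-negligible (\bigcup_i N i).
Proof.
move=> N0; apply: (@negligibleS _ _ _ _ (\bigcup_n
    if unpickle n is Some i then N i else set0)).
  move=> w [i _ Ni].
  by exists (pickle i); [exact: Logic.I|rewrite pickleK].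
apply: negligible_bigcup => n.
by case: unpickle => // *; exact: negligible_set0.
Qed.

Section debut.
Context (R : realType) d (T : measurableType d) (mu : probability T R).
Context (G : R -> set (set T)) (D : T -> R -> R) (tau : T -> \bar R).
Hypothesis filtG : right_continuous_filtration G.
Hypothesis adaptedD : forall q, 0 <= q -> forall c, G q [set w | D w q < c].
Hypothesis tau_ge0 : forall w, (0 <= tau w)%E.
Hypothesis tau_closed : forall w x, (0 <= x)%E -> (x <= tau w)%E ->
  (next_small (D w) x <= tau w)%E.

Let below (S : T -> \bar R) := optional_time G S /\ forall w, (S w <= tau w)%E.

Let sG t (t0 : 0 <= t) : sigma_algebra [set: T] (G t).
Proof. by case: filtG => + _ _ _; exact. Qed.

Lemma optional_sup (I : countType) (i0 : I) (S : I -> T -> \bar R) :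
  (forall i, below (S i)) ->
  below (fun w => ereal_sup (range (fun i => S i w))).
Proof.
move=> belowS; split; last first.
  by move=> w; apply/ereal_supP => _ [i _ <-]; case: (belowS i).
split=> [w|t t0].
  apply: le_ereal_sup_tmp; exists (S i0 w); first by exists i0.
  by case: (belowS i0) => -[].
rewrite (_ : [set w | _] = \bigcap_i [set w | (S i w <= t%:E)%E]).
  by apply: (sigma_bigcap (sG t0)) => i; have [[_ GS] _] := belowS i; exact: GS.
apply/seteqP; split => w /=.
  by move=> /ereal_supP h i _; apply: h; exists i.
by move=> h; apply/ereal_supP => _ [i _ <-]; exact: h.
Qed.

Lemma optional_next_small (S : T -> \bar R) :
  below S -> below (fun w => next_small (D w) (S w)).
Proof.
move=> [[S0 GS] Stau]; have [_ _ ndG rcG] := filtG; split; last first.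
  by move=> w; apply: tau_closed.
split=> [w|t t0]; first exact: le_trans (S0 w) (le_next_small _ _).
pose I n w := ereal_inf [set (ratr q : R)%:E | q in [set q : rat |
      (S w <= (ratr q)%:E)%E /\ D w (ratr q) < n.+1%:R^-1]].
have GI n a : 0 <= a -> G a [set w | (I n w < a%:E)%E].
  move=> a0; rewrite (_ : [set w | _] = \bigcup_(q : rat)
    (if ((0 <= ratr q :> R) && (ratr q < a)) then
     [set w | (S w <= (ratr q)%:E)%E] `&` [set w | D w (ratr q) < n.+1%:R^-1]
     else set0)).
    apply: (sigma_bigcup (sG a0)) => q.
    case: ifPn => [/andP[q0 qa]|_]; last exact: sigma_set0 (sG a0).
    apply: (ndG _ _ q0 (ltW qa)); apply: (sigma_setI (sG q0)); first exact: GS.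
    exact: adaptedD.
  apply/seteqP; split=> [w /ereal_inf_ltP[_ [q [Sq Dq] <-]]|w [q _]].
    rewrite lte_fin => qa; exists q => //; rewrite qa andbT ifT//.
    by rewrite -lee_fin (le_trans (S0 w)).
  case: ifPn => // /andP[_ qa] [/= Sq Dq].
  by apply/ereal_inf_ltP; exists (ratr q)%:E; [exists q|rewrite lte_fin].
rewrite (_ : [set w | _] = \bigcap_n [set w | (I n w <= t%:E)%E]); last first.
  apply/seteqP; split=> [w /ereal_supP h n _|w h].
    by apply: h; exists n.
  by apply/ereal_supP => _ [n _ <-]; exact: h.
apply: (sigma_bigcap (sG t0)) => n.
apply: rcG => // s /= ts.
rewrite (_ : [set w | _] =
  \bigcap_k [set w | (I n w < (t + (s - t) / k.+1%:R)%:E)%E]); last first.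
  apply/seteqP; split=> [w /= h k _|w h] /=.
    by apply: le_lt_trans h _; rewrite lte_fin ltrDl divr_gt0// subr_gt0.
  apply/lee_addgt0Pr => e e0.
  have st0 : 0 < s - t by rewrite subr_gt0.
  have [k] := ltr_add_invr (divr_gt0 e0 st0); rewrite add0r => ke.
  apply: (le_trans (ltW (h k Logic.I))); rewrite -EFinD lee_fin lerD2l.
  by rewrite mulrC -ler_pdivlMr ?subr_gt0// ltW.
have s0 : 0 <= s by rewrite (le_trans t0)// ltW.
apply: (sigma_bigcap (sG s0)) => k.
have tk0 : 0 <= t + (s - t) / k.+1%:R.
  by rewrite addr_ge0// divr_ge0// subr_ge0 ltW.
apply: (ndG (t + (s - t) / k.+1%:R)) => //; last exact: GI.
rewrite -lerBrDl ler_pdivrMr// ler_peMr ?subr_ge0 ?(ltW ts)//.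
by rewrite ler1n.
Qed.

Lemma optional_measurable (S : T -> \bar R) : below S ->
  forall t, measurable [set w | (S w <= t%:E)%E].
Proof.
move=> [[S0 GS] _] t; have [t0|t0] := leP 0 t.
  by have [_ mG _ _] := filtG; apply: mG (GS t t0).
rewrite (_ : [set w | _] = set0); first exact: measurable0.
apply/seteqP; split=> // w /= Swt; have := le_trans (S0 w) Swt.
by rewrite lee_fin leNgt t0.
Qed.

(** The infimum is attained, by the supremum of a minimizing sequence. *)
Lemma below_minimizes (q : R) : exists2 S, below S &
  forall S', below S' ->
    (mu [set w | (S w <= q%:E)%E] <= mu [set w | (S' w <= q%:E)%E])%E.
Proof.
pose V := [set mu [set w | (S w <= q%:E)%E] | S in below].
have below0 : below (fun=> 0%E).
  split=> //; split=> // t t0; rewrite (_ : [set w | _] = ~` set0).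
    exact: sigma_setC (sG t0) _ (sigma_set0 (sG t0)).
  by rewrite setC0; apply/seteqP; split=> // w _ /=; rewrite lee_fin.
have Vfin : ereal_inf V \is a fin_num.
  rewrite ge0_fin_numE; last by apply/ereal_infP => _ [S _ <-].
  apply: (@le_lt_trans _ _ 1%E); last exact: ltry.
  apply: ge_ereal_inf; eexists; first by exists (fun=> 0%E).
  by rewrite probability_le1//; exact: (optional_measurable below0).
have /choice[S SP] (n : nat) : exists S, below S /\
    (mu [set w | (S w <= q%:E)%E] < ereal_inf V + (n.+1%:R^-1)%:E)%E.
  have [|_ [S bS <-] lt] := @lb_ereal_inf_adherent R V n.+1%:R^-1 _ Vfin.
    by rewrite invr_gt0.
  by exists S.
have bS := optional_sup 0%N (fun n => (SP n).1).
eexists; first exact: bS.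
move=> S' bS'; apply: (@le_trans _ _ (ereal_inf V)); last first.
  by apply: ereal_inf_lbound; exists S'.
apply/lee_addgt0Pr => e e0; have [n] := ltr_add_invr e0; rewrite add0r => ne.
apply: (@le_trans _ _ (mu [set w | (S n w <= q%:E)%E])).
  apply: le_measure; rewrite ?inE.
  - exact: (optional_measurable bS).
  - exact: (optional_measurable (SP n).1).
  - by move=> w /= /ereal_supP; apply; exists n.
by apply: (le_trans (ltW (SP n).2)); rewrite leeD2l// lee_fin ltW.
Qed.

(** Among the optional times below tau there is an almost surely largest one: it
    minimizes simultaneously, for all rational q, the mass of the event that it
    occurs before q.  Being maximal, it is almost surely fixed by next_small. *)
Lemma debut : exists S : T -> \bar R,
  [/\ optional_time G S, forall w, (S w <= tau w)%E &
      mu.-negligible [set w | next_small (D w) (S w) <> S w]].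
Proof.
have /choice[S SP] (q : rat) : exists S, below S /\ forall S', below S' ->
    (mu [set w | (S w <= (ratr q)%:E)%E] <= mu [set w | (S' w <= (ratr q)%:E)%E])%E.
  by have [S bS SP] := below_minimizes (ratr q); exists S.
have bS := optional_sup (0 : rat) (fun q => (SP q).1).
set Z := (fun w => _) in bS; have [oZ Ztau] := bS.
have bZ' := optional_next_small bS.
exists Z; split => //.
pose N (q : rat) := [set w | (Z w <= (ratr q)%:E)%E] `\`
                    [set w | (next_small (D w) (Z w) <= (ratr q)%:E)%E].
have mZ q : measurable [set w | (Z w <= (ratr q)%:E)%E].
  exact: optional_measurable bS _.
have mZ' q : measurable [set w | (next_small (D w) (Z w) <= (ratr q)%:E)%E].
  exact: optional_measurable bZ' _.
have N0 q : mu.-negligible (N q).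
  apply/negligibleP; first exact: measurableD.
  have E : mu [set w | (Z w <= (ratr q)%:E)%E] =
      mu [set w | (next_small (D w) (Z w) <= (ratr q)%:E)%E].
    apply/eqP; rewrite eq_le; apply/andP; split; last first.
      apply: le_measure; rewrite ?inE //.
      by move=> w /=; apply: le_trans; exact: le_next_small.
    apply: (le_trans _ ((SP q).2 _ bZ')); apply: le_measure; rewrite ?inE //.
      exact: (optional_measurable (SP q).1).
    by move=> w /= /ereal_supP; apply; exists q.
  rewrite /N measureD//; last by rewrite -ge0_fin_numE// fin_num_measure.
  rewrite setIidr; last by move=> w /=; apply: le_trans; exact: le_next_small.
  by rewrite [X in (X - _)%E]E; apply: subee; rewrite fin_num_measure.
apply: negligibleS (negligible_bigcup_countable N0).
move=> w /= neq; have : (Z w < next_small (D w) (Z w))%E.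
  by rewrite lt_neqAle le_next_small andbT eq_sym; exact/eqP.
have := oZ.1 w; case EZ : (Z w) => [z| |] // _ zlt; last first.
  by move: zlt; rewrite ltNge leey.
have [q zq qlt] : exists2 q : rat, z <= ratr q &
    ((ratr q)%:E < next_small (D w) z%:E)%E.
  case: (next_small _ _) zlt => [r|_|] //.
    rewrite lte_fin => /rat_in_itvoo[q]; rewrite in_itv/= => /andP[zq qr].
    by exists q; rewrite ?lte_fin// ltW.
  have [|q] := @rat_in_itvoo R z (z + 1); first by rewrite ltrDl.
  by rewrite in_itv/= => /andP[zq _]; exists q; rewrite ?ltry// ltW.
exists q => //; split => /=; rewrite EZ ?lee_fin//.
by apply/negP; rewrite -ltNge.
Qed.

End debut.

(** * Measurability on path space *)

Section path_measurability.
Context (R : realType) (m d : nat).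

Lemma measurable_coordinate (i : 'I_m) (k : 'I_d) :
  measurable_fun setT (fun x : config R m d => x i ord0 k).
Proof.
by move=> _ B mB; rewrite setTI; apply: sub_sigma_algebra; exists i, k, B.
Qed.

Lemma measurable_to_config d' (T : measurableType d') (f : T -> config R m d) :
  (forall i k, measurable_fun setT (fun w => f w i ord0 k)) ->
  measurable_fun setT f.
Proof.
move=> mf; apply: (@measurability _ _ T (config R m d) setT f (@coordinate_sets R m d)) => //.
move=> _ [_ [i [k [B mB ->]]] <-].
exact: mf.
Qed.

Lemma measurable_at (t : R) : 0 <= t ->
  measurable_fun setT (fun w : path_space R m d => (w t : config R m d)).
Proof.
by move=> t0 _ B mB; rewrite setTI; apply: sub_sigma_algebra; exists t => //; exists B.
Qed.

Lemma measurable_to_path d' (T : measurableType d') (f : T -> path_space R m d) :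
  (forall t, 0 <= t -> measurable_fun setT (fun w => (f w t : config R m d))) ->
  measurable_fun setT f.
Proof.
move=> mf; apply: (@measurability _ _ T (path_space R m d) setT f (@cylinder_sets R m d)) => //.
move=> _ [_ [t t0 [B mB ->]] <-].
exact: mf.
Qed.

Lemma measurable_gap (i j : 'I_m) (c : R) :
  measurable [set x : config R m d | `|x i - x j| < c].
Proof.
have [c0|c0] := ltP 0 c; last first.
  rewrite (_ : [set _ | _] = set0); first exact: measurable0.
  by apply/seteqP; split=> // x /= /lt_le_trans/(_ c0); rewrite normr_lt0.
have mk k : measurable [set x : config R m d | `|x i ord0 k - x j ord0 k| < c].
  have := measurable_funB (measurable_coordinate i k) (measurable_coordinate j k).
  move=> /(measurableT_comp (@normr_measurable R setT)) mn.
  by rewrite -[X in measurable X]setTI; exact: (mn _ _ (measurable_itv `]-oo, c[)).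
rewrite (_ : [set _ | _] = \bigcap_(k in [set: 'I_d])
    [set x : config R m d | `|x i ord0 k - x j ord0 k| < c]).
  by apply: fin_bigcap_measurable => //; exact: finite_finset.
apply/seteqP; split=> x; rewrite /= /Num.Def.normr/= mx_normrE.
  move=> /bigmax_ltP[_ h] k _ /=; have := h (ord0, k) isT.
  by rewrite !mxE.
move=> h; apply/bigmax_ltP; split=> // -[k' k] _ /=.
by rewrite !mxE (ord1 k'); exact: h.
Qed.

End path_measurability.

(** * The meeting time as an optional time *)

Definition gap (R : realType) (m d : nat) (w : R -> config R m d) (i j : 'I_m)
  (t : R) : R := `|w t i - w t j|.

(** The meeting time of a path that need not belong to a process, written as the
    first zero of a real function. *)
Definition meet (R : realType) (m d : nat) (w : R -> config R m d) (i j : 'I_m)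
  : \bar R := first_zero (gap w i j).

Definition right_continuous_path (R : realType) (m d : nat)
    (w : R -> config R m d) :=
  forall (i : 'I_m) (t : R), 0 <= t ->
    (fun s => (w s i : 'rV[R]_d)) @ t^'+ --> (w t i : 'rV[R]_d).

Section paths.
Context (R : realType) (m d : nat).
Implicit Types w : R -> config R m d.

Lemma gap_ge0 w i j t : 0 <= gap w i j t.
Proof. exact: normr_ge0. Qed.

Lemma gap_right_continuous w i j :
  right_continuous_path w -> right_continuous_from0 (gap w i j).
Proof.
move=> wrc t t0; rewrite /gap.
exact: (cvg_norm (cvgB (wrc i t t0) (wrc j t t0))).
Qed.

Lemma right_continuous_shift w (s : R) : 0 <= s ->
  right_continuous_path w -> right_continuous_path (fun t => w (s + t)).
Proof.
move=> s0 wrc i t t0; have /cvgrPdist_lt h := wrc i (s + t) (addr_ge0 s0 t0).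
apply/cvgrPdist_lt => e e0; have := h e e0 => -[r /= r0 rP].
exists r => //= u; rewrite /ball_/= => tu ltu; apply: rP => /=.
  by rewrite opprD addrACA subrr add0r.
by rewrite ltrD2l.
Qed.

End paths.

Section process.
Context (R : realType) (m d : nat) (discrete : bool).
Context (Q : R.-pker (config R m d) ~> (path_space R m d)) (z : config R m d).
Context (Z : process discrete Q z).
Implicit Types (i j : 'I_m) (w : Defs.space Z).

Lemma traj_rc w : right_continuous_path (fun t => traj t w).
Proof. by move=> i t t0; exact: traj_right_continuous. Qed.

Lemma meeting_timeE i j w : meeting_time Z i j w = meet (fun t => traj t w) i j.
Proof.
rewrite /meeting_time /meet /first_zero; congr ereal_inf; congr image.
apply/seteqP; split => t [t0 /= e]; split => //; rewrite /gap.
  by rewrite e subrr normr0.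
by move/eqP: e; rewrite /gap normr_eq0 subr_eq0 => /eqP.
Qed.

Lemma filt_filtration (S : filtered_space R) : right_continuous_filtration (@filt R S).
Proof.
by split; [exact: filt_sigma_algebra|exact: filt_measurable|
  exact: filt_nondecreasing|exact: filt_right_continuous].
Qed.

Lemma null_filt (S : filtered_space R) (N : set S) (t : R) : 0 <= t ->
  (fs_prob S).-negligible N -> filt t N.
Proof.
move=> t0 /filt_complete; exact: filt_nondecreasing.
Qed.

(** Outside a null set the meeting time is the optional time found by debut, and
    completeness puts null sets into the filtration. *)
Lemma meeting_time_optional i j : stopping_time (meeting_time Z i j).
Proof.
have gapE w : meeting_time Z i j w = first_zero (gap (fun t => traj t w) i j).
  exact: meeting_timeE.
have grc w := @gap_right_continuous _ _ _ _ i j (@traj_rc w).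
have g0 w t := gap_ge0 (fun t => traj t w) i j t.
have [||||S [[S0 GS] Sle Snull]] := @debut R _ (Defs.space Z) (fs_prob (Defs.space Z))
  (@filt R (Defs.space Z)) (fun w => gap (fun t => traj t w) i j) (meeting_time Z i j).
- exact: filt_filtration.
- move=> q q0 c; have := traj_adapted Z q0 (measurable_gap i j c); exact.
- by move=> w; rewrite gapE; exact: first_zero_ge0.
- by move=> w x x0; rewrite gapE; apply: next_small_le.
set N := [set w | _] in Snull.
have SE w : ~ N w -> S w = meeting_time Z i j w.
  move=> /contrapT fixS; apply/eqP; rewrite eq_le Sle gapE.
  by apply: first_zero_le_fixpoint.
split=> [w|t t0]; first by rewrite gapE; exact: first_zero_ge0.
have sF := @filt_sigma_algebra R (Defs.space Z) t t0.
rewrite (_ : [set w | _] = ([set w | (S w <= t%:E)%E] `&` ~` N) `|`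
  ([set w | (meeting_time Z i j w <= t%:E)%E] `&` N)); last first.
  apply/seteqP; split=> w /=.
    by have [Nw|Nw] := pselect (N w); [right|left; rewrite SE].
  by case=> [[+ /SE <-]//|[]].
apply: (sigma_setU sF); last first.
  apply: null_filt => //; apply: negligibleS Snull; exact: subIsetr.
apply: (sigma_setI sF); first exact: GS.
apply: (sigma_setC sF); exact: null_filt.
Qed.

Lemma meeting_time_measurable i j (t : R) : 0 <= t ->
  filt t [set w | (t%:E < meeting_time Z i j w)%E].
Proof.
move=> t0; rewrite (_ : [set w | _] = ~` [set w | (meeting_time Z i j w <= t%:E)%E]).
  apply: (sigma_setC (filt_sigma_algebra (Defs.space Z) t0)).
  by case: (meeting_time_optional i j) => _; exact.
by apply/seteqP; split=> w /=; rewrite ltNge => /negP.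
Qed.

End process.

(** * The Markov property and the tail of the meeting time *)

Section minorant.
Context (R : realType) (m d : nat) (i j : 'I_m).

(** With the constant filtration, optional times are just nonnegative
    measurable functions. *)
Lemma constant_filtration d' (T : measurableType d') :
  right_continuous_filtration (fun _ : R => @measurable _ T).
Proof.
split=> [t _|t _|s t _ _|t _ A] //; first exact: sigma_algebra_measurable.
by move=> /(_ (t + 1)); apply; rewrite /= ltrDl.
Qed.

(** The meeting time is not a measurable function on path space, where arbitrary
    paths are allowed; it nevertheless agrees almost surely, for every random
    right-continuous path, with some measurable function bounding it from
    below. *)
Lemma meet_minorant d' (T : measurableType d') (P : probability T R)
    (W : T -> path_space R m d) : measurable_fun setT W ->
  exists S : path_space R m d -> \bar R,
  [/\ forall t : R, 0 <= t -> measurable [set w | (t%:E < S w)%E],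
      forall w, right_continuous_path w -> (S w <= meet w i j)%E &
      P.-negligible
        [set x | right_continuous_path (W x) /\ S (W x) <> meet (W x) i j]].
Proof.
move=> mW.
pose tau (w : path_space R m d) : \bar R :=
  if `[< right_continuous_path w >] then meet w i j else +oo%E.
pose mu := distribution P (mfun_Sub (mem_set mW)).
have grc w := @gap_right_continuous R m d w i j.
have g0 w t := gap_ge0 w i j t.
have [||||S [[S0 GS] Sle Snull]] := @debut R _ (path_space R m d) mu
  (fun=> measurable) (fun w => gap w i j) tau.
- exact: constant_filtration.
- move=> q q0 c; have := @measurable_at R m d q q0 measurableT _ (measurable_gap i j c).
  by rewrite setTI; exact.
- by move=> w; rewrite /tau; case: ifP => // _; exact: first_zero_ge0.
- move=> w x x0; rewrite /tau; case: ifPn => [/asboolP wrc|_ _]; last exact: leey.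
  by apply: next_small_le => //; exact: grc.
have Sle' w : right_continuous_path w -> (S w <= meet w i j)%E.
  by move=> /asboolP wrc; have := Sle w; rewrite /tau wrc.
exists S; split => //.
  move=> t t0; rewrite (_ : [set w | _] = ~` [set w | (S w <= t%:E)%E]).
    by apply: measurableC; exact: GS.
  by apply/seteqP; split=> w /=; rewrite ltNge => /negP.
case: Snull => N [mN muN NN].
exists (W @^-1` N); split => //.
  by have := mW measurableT _ mN; rewrite setTI.
move=> x [Wrc Sx]; apply: NN => /= fixS; apply: Sx; apply/eqP.
rewrite eq_le Sle'//; apply: first_zero_le_fixpoint => //; exact: grc.
Qed.

End minorant.

Lemma measurable_pair (R : realType) (m d : nat) (i j : 'I_m) :
  measurable_fun setT (fun w : path_space R m d =>
    (fun t => pair_config (w t i) (w t j)) : path_space R 2 d).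
Proof.
apply: measurable_to_path => t t0; apply: measurable_to_config => a k.
rewrite /pair_config; case: (a == ord0);
  exact: (measurableT_comp (measurable_coordinate _ k) (measurable_at t0)).
Qed.

Section trajectories.
Context (R : realType) (m d : nat) (discrete : bool).
Context (Q : R.-pker (config R m d) ~> (path_space R m d)) (z : config R m d).
Context (Z : process discrete Q z).

Lemma measurable_traj :
  measurable_fun setT (fun w : Defs.space Z =>
    (fun t => traj t w) : path_space R m d).
Proof.
apply: measurable_to_path => t t0 _ B mB; rewrite setTI.
exact: filt_measurable (traj_adapted Z t0 mB).
Qed.

Lemma measurable_state (t : R) : 0 <= t ->
  measurable_fun setT (fun w : Defs.space Z => traj t w).
Proof.
move=> t0; exact: (measurableT_comp (measurable_at t0) measurable_traj).
Qed.

Lemma stopping_cst (s : R) : 0 <= s ->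
  stopping_time (fun _ : Defs.space Z => s%:E).
Proof.
move=> s0; split=> [_|t t0]; first by rewrite lee_fin.
have sF := @filt_sigma_algebra R (Defs.space Z) t t0.
rewrite /= lee_fin; have [st|st] := leP s t.
  by rewrite set_true -setC0; exact/(sigma_setC sF)/(sigma_set0 sF).
by rewrite set_false; exact: (sigma_set0 sF).
Qed.

Lemma before_cst (s : R) (E : set (Defs.space Z)) : 0 <= s -> filt s E ->
  before (fun=> s%:E) E.
Proof.
move=> s0 sE; split=> [|t t0]; first exact: filt_measurable sE.
have sF := @filt_sigma_algebra R (Defs.space Z) t t0.
rewrite /= lee_fin; have [st|st] := leP s t.
  by rewrite set_true setIT; exact: filt_nondecreasing sE.
by rewrite set_false setI0; exact: (sigma_set0 sF).
Qed.

Lemma traj_Markov (s : R) (E : set (Defs.space Z)) (A : set (path_space R m d)) :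
  0 <= s -> time_set discrete s -> filt s E -> measurable A ->
  fs_prob (Defs.space Z) (E `&` [set w | A (fun t => traj (s + t) w)]) =
  (\int[fs_prob (Defs.space Z)]_(w in E) Q (traj s w) A)%E.
Proof.
move=> s0 sT sE mA.
have := @traj_strong_Markov _ _ _ _ _ _ Z (fun=> s%:E) (stopping_cst s0) _ E
  (before_cst s0 sE) A mA.
rewrite (_ : [set w | (s%:E < +oo)%E] = setT) ?setIT; last first.
  by rewrite -subTset => w _ /=; exact: ltry.
by apply=> w; right; exists s.
Qed.

End trajectories.
Arguments measurable_traj {R m d discrete Q z} Z.
Arguments measurable_state {R m d discrete Q z} Z {t}.

Section markov.
Context (R : realType) (d : nat) (discrete : bool).
Context (Q : forall m, R.-pker (config R m d) ~> (path_space R m d)).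
Context (Z : forall m (z : config R m d), process discrete (Q m) z).
Hypothesis Q_consistent : dimension_consistent Q.
Context (u : R) (c : R).
Hypothesis u_ge0 : 0 <= u.
Hypothesis pair_tail : forall x y : 'rV[R]_d,
  let Zxy := Z (pair_config x y) in
  (prob Zxy [set w | u%:E < meeting_time Zxy ord0 ord_max w] <= c%:E)%E.

(** On the event that i and j have not met by time s, restart the process at s and
    apply the bound to their new positions.  The event that the restarted pair
    does not meet for a further u is not an event of path space, so it is replaced
    by the one defined by a measurable minorant S of the meeting time; S agrees
    with the meeting time for the restarted pair, and being a minorant it
    satisfies the bound for all starting points. *)
Lemma tail_step m (z : config R m d) (i j : 'I_m) (s : R) :
  i != j -> 0 <= s -> time_set discrete s ->
  (prob (Z z) [set w | (s + u)%:E < meeting_time (Z z) i j w] <=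
   c%:E * prob (Z z) [set w | s%:E < meeting_time (Z z) i j w])%E.
Proof.
move=> ij s0 sT; pose P := fs_prob (Defs.space (Z z)).
pose pair (w : path_space R m d) : path_space R 2 d :=
  fun t => pair_config (w t i) (w t j).
pose W (w : Defs.space (Z z)) : path_space R 2 d :=
  pair (fun t => traj (s + t) w).
have mW : measurable_fun setT W.
  apply: measurable_to_path => t t0; apply: measurable_to_config => a k.
  have ms := measurable_state (Z z) (addr_ge0 s0 t0).
  by rewrite /W /pair /pair_config; case: (a == ord0);
    exact: measurableT_comp (measurable_coordinate _ k) ms.
have Wrc w : right_continuous_path (W w).
  have wrc := right_continuous_shift s0 (@traj_rc _ _ _ _ _ _ (Z z) w).
  by move=> a t t0; rewrite /W /pair /pair_config; case: (a == ord0); exact: wrc.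
have [S [mS Sle Snull]] := @meet_minorant R 2 d ord0 ord_max _ _ P W mW.
pose A := pair @^-1` [set w | (u%:E < S w)%E].
have mA : measurable A.
  by have := measurable_pair i j measurableT (mS u u_ge0); rewrite setTI.
pose E := [set w | (s%:E < meeting_time (Z z) i j w)%E].
have sE : filt s E by exact: meeting_time_measurable.
have mE : measurable E := filt_measurable s0 sE.
have QA z' : (Q m z' A <= c%:E)%E.
  rewrite Q_consistent//; last exact: mS.
  rewrite -(traj_law (Z _))//; last exact: mS.
  apply: le_trans (pair_tail _ _); apply: le_measure; rewrite ?inE.
  - have := measurable_traj (Z (pair_config (z' i) (z' j))).
    by move=> /(_ measurableT _ (mS u u_ge0)); rewrite setTI.
  - apply: (filt_measurable u_ge0); exact: meeting_time_measurable.
  - move=> w /= /lt_le_trans; apply; rewrite meeting_timeE; apply: Sle.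
    exact: traj_rc.
have mWA : measurable [set w : Defs.space (Z z) | A (fun t => traj (s + t) w)].
  have := mW measurableT _ (mS u u_ge0); rewrite setTI; exact.
apply: (@le_trans _ _ (P (E `&` [set w : Defs.space (Z z) | A (fun t => traj (s + t) w)]))).
  set N := [set x | _] in Snull.
  have mN : measurable N := fs_complete Snull.
  rewrite -[leRHS]adde0 -(measure_negligible mN Snull).
  apply: le_trans (measureU2 P (measurableI _ _ mE mWA) mN).
  apply: le_measure; rewrite ?inE.
  - have su0 := addr_ge0 s0 u_ge0.
    by apply: (filt_measurable su0); exact: meeting_time_measurable.
  - by apply: measurableU => //; exact: measurableI.
  move=> w /= suw; have [Nw|Nw] := pselect (N w); [by right|left].
  split.
    by apply: le_lt_trans suw; rewrite lee_fin lerDl.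
  rewrite /A /=.
  have -> : S (W w) = meet (W w) ord0 ord_max.
    by apply: contrapT => h; apply: Nw; split => //; exact: Wrc.
  rewrite ltNge; apply/negP => muw.
  have := first_zero_attained (gap_ge0 (W w) ord0 ord_max)
    (gap_right_continuous (Wrc w)) muw.
  move=> [v [v0 vu _ /eqP]]; rewrite normr_eq0 subr_eq0 => /eqP /= vw.
  move: suw; rewrite ltNge => /negP; apply.
  apply: (@le_trans _ _ (s + v)%:E); last by rewrite lee_fin lerD2l.
  by apply: ereal_inf_lbound; exists (s + v) => //; split => //; exact: addr_ge0.
rewrite traj_Markov//.
apply: (@le_trans _ _ (\int[P]_(w in E) (cst c%:E w))%E); last first.
  by rewrite integral_cst.
have mQ : measurable_fun E (fun w => Q m (traj s w) A).
  apply: measurable_funTS.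
  exact: measurableT_comp (measurable_kernel (Q m) A mA)
    (measurable_state (Z z) s0).
exact: ge0_le_integral.
Qed.

Lemma tail_power m (z : config R m d) (i j : 'I_m) (k : nat) :
  i != j -> time_set discrete u ->
  (prob (Z z) [set w | (k%:R * u)%:E < meeting_time (Z z) i j w] <=
   (c ^+ k)%:E)%E.
Proof.
move=> ij uT; have c0 : 0 <= c.
  rewrite -lee_fin; apply: le_trans (pair_tail 0 0); exact: measure_ge0.
elim: k => [|k IH].
  rewrite expr0; apply: probability_le1.
  rewrite mul0r; apply: (filt_measurable (lexx 0)).
  exact: meeting_time_measurable.
have ku0 : 0 <= k%:R * u by rewrite mulr_ge0.
have kuT : time_set discrete (k%:R * u).
  move: uT; rewrite /time_set; case: (discrete) => [[n _ <-]|_] //=.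
  by exists (k * n)%N => //; rewrite natrM.
rewrite -natr1 mulrDl mul1r; apply: (le_trans (tail_step z ij ku0 kuT)).
by rewrite exprS (EFinM c); apply: lee_wpmul2l; rewrite ?lee_fin.
Qed.

End markov.

Section discrete_time.
Context (R : realType) (m d : nat) (discrete : bool).
Context (Q : R.-pker (config R m d) ~> (path_space R m d)) (z : config R m d).
Context (Z : process discrete Q z).
Hypothesis discreteT : discrete.

(** Between integers the path does not move, so the first meeting occurs at an
    integer. *)
Lemma meeting_time_floor (i j : 'I_m) (t : R) (w : Defs.space Z) : 0 <= t ->
  (meeting_time Z i j w <= t%:E)%E ->
  exists n : nat, [/\ n%:R <= t, meeting_time Z i j w = n%:R%:E &
    traj n%:R w i = traj n%:R w j].
Proof.
move=> t0; rewrite meeting_timeE => tau_t.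
have := first_zero_attained (gap_ge0 _ i j)
  (@gap_right_continuous _ _ _ _ i j (@traj_rc _ _ _ _ _ _ Z w)) tau_t.
rewrite -/(meet _ i j) => -[s [s0 st tau_s /eqP]].
rewrite normr_eq0 subr_eq0 => /eqP meet_s.
have ns : (Num.truncn s)%:R <= s by rewrite truncn_le.
exists (Num.truncn s); split; first exact: le_trans st.
  apply/eqP; rewrite eq_le {2}tau_s lee_fin ns andbT.
  rewrite -meeting_timeE; apply: ereal_inf_lbound; exists (Num.truncn s)%:R => //.
  by split; [exact: ler0n|rewrite -!(traj_interpolated discreteT w s0)].
by rewrite -!(traj_interpolated discreteT w s0).
Qed.

End discrete_time.

Section tail_bounds.
Context (R : realType) (d : nat) (discrete : bool).
Context (Q : forall m, R.-pker (config R m d) ~> (path_space R m d)).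
Context (Z : forall m (z : config R m d), process discrete (Q m) z).
Hypothesis d_gt0 : (0 < d)%N.
Hypothesis Q_consistent : dimension_consistent Q.

Definition pair_tail_le (u c : R) := forall x y : 'rV[R]_d,
  let Zxy := Z (pair_config x y) in
  (prob Zxy [set w | u%:E < meeting_time Zxy ord0 ord_max w] <= c%:E)%E.

(** In discrete time two distinct points do not meet before time 1, so that a
    nontrivial bound can only hold at a time u >= 1.  Rounding u down to an
    integer, where the Markov property is available, does not change the event. *)
Lemma pair_tail_time (u c : R) : 0 < u -> c < 1 -> pair_tail_le u c ->
  exists v : R, [/\ 0 < v, v <= u, time_set discrete v & pair_tail_le v c].
Proof.
rewrite /pair_tail_le => u0 c1; case: discrete Z => Z' tail; last first.
  by exists u; split => //; exact: ltW.
pose n := Num.truncn u.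
have nu : n%:R <= u by rewrite truncn_le ltW.
have setE (x y : 'rV[R]_d) (Zxy := Z' 2%N (pair_config x y)) :
    [set w | (u%:E < meeting_time Zxy ord0 ord_max w)%E] =
    [set w | (n%:R%:E < meeting_time Zxy ord0 ord_max w)%E].
  apply/seteqP; split=> w /=; first by apply: le_lt_trans; rewrite lee_fin.
  rewrite !ltNge; apply: contra => /(meeting_time_floor isT (ltW u0)) [k [ku -> _]].
  by rewrite lee_fin ler_nat /n; rewrite truncn_ge_nat// ltW.
have u1 : 1 <= u.
  rewrite leNgt; apply/negP => ult1.
  have n0 : n = 0%N by apply/truncn0Pn; rewrite -ltNge.
  pose y : 'rV[R]_d := const_mx 1.
  have := tail 0 y; rewrite /= setE n0 leNgt => /negP; apply.
  rewrite (_ : [set w | _] = setT).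
    by rewrite (@probability_setT _ _ R (prob (Z' _ _))) lte_fin.
  rewrite -subTset => w _ /=; rewrite ltNge; apply/negP.
  move=> /(meeting_time_floor isT (lexx 0)) [k [k0 _]].
  have -> : k = 0%N by apply/eqP; rewrite -leqn0 -(ler_nat R).
  rewrite traj0 /pair_config /= => /rowP /(_ (Ordinal d_gt0)).
  by rewrite !mxE => /eqP; rewrite eq_sym oner_eq0.
exists n%:R; split => //.
- by rewrite ltr0n /n truncn_gt_nat.
- by exists n.
- by move=> x y /=; rewrite -setE; exact: tail.
Qed.

Lemma tail_geometric (u c : R) : 0 < u -> 0 <= c -> c < 1 -> pair_tail_le u c ->
  forall m (z : config R m d) (i j : 'I_m), i != j ->
  forall t : R, 0 <= t ->
  (prob (Z z) [set w | t%:E < meeting_time (Z z) i j w] <=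
   (c ^+ Num.truncn (t / u))%:E)%E.
Proof.
move=> u0 c0 c1 tail m z i j ij t t0.
have [v [v0 vu vT tailv]] := pair_tail_time u0 c1 tail.
set k := Num.truncn (t / u).
have kvt : k%:R * v <= t.
  rewrite (@le_trans _ _ (k%:R * u))//; first by rewrite ler_wpM2l.
  by rewrite -ler_pdivlMr// truncn_le divr_ge0// ltW.
apply: le_trans (tail_power Q_consistent (ltW v0) tailv z k ij vT).
apply: le_measure; rewrite ?inE.
- by apply: (filt_measurable t0); exact: meeting_time_measurable.
- have kv0 : 0 <= k%:R * v by rewrite mulr_ge0// ltW.
  by apply: (filt_measurable kv0); exact: meeting_time_measurable.
by move=> w /=; apply: le_lt_trans; rewrite lee_fin.
Qed.

End tail_bounds.

(** * Exponential tails *)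

Section dominating_time.
Context (R : realType) (d : measure_display) (T : measurableType d).
Context (P : probability T R) (zeta : {RV P >-> R}).

Lemma measurable_tail (t : R) : measurable [set w | t < zeta w].
Proof.
have := measurable_funP zeta measurableT _ (measurable_itv `]t, +oo[).
rewrite setTI; congr measurable.
by apply/seteqP; split=> w /=; rewrite in_itv/= andbT.
Qed.

Lemma measurable_head (t : R) : measurable [set w | zeta w <= t].
Proof.
rewrite (_ : [set w | _] = ~` [set w | t < zeta w]).
  exact/measurableC/measurable_tail.
by apply/seteqP; split=> w /=; rewrite leNgt => /negP.
Qed.

Lemma tail_head (t : R) :
  P [set w | t < zeta w] = (1 - P [set w | (zeta w <= t)%R])%E.
Proof.
rewrite -probability_setC; last exact: measurable_head.
by congr (P _); apply/seteqP; split=> w /=; rewrite ltNge => /negP.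
Qed.

Lemma small_tail (e : R) : 0 < e ->
  exists M : R, 0 < M /\ (P [set w | (M < zeta w)%R] <= e%:E)%E.
Proof.
move=> e0; pose F (n : nat) := [set w | n%:R < zeta w].
have F0 : \bigcap_n F n = set0.
  rewrite -subset0 => w /(_ (Num.truncn (zeta w)).+1 Logic.I).
  by rewrite /F /= ltNge ltW// truncnS_gt.
have cvgF : (P \o F) x @[x --> \oo] --> 0%E.
  rewrite -(measure0 P) -F0; apply: nonincreasing_cvg_mu.
  - by rewrite -ge0_fin_numE// fin_num_measure//; exact: measurable_tail.
  - by move=> n; exact: measurable_tail.
  - by rewrite F0.
  - move=> n k nk; apply/subsetPset => w /=; apply: le_lt_trans.
    by rewrite ler_nat.
have /cvgF : nbhs (0%:E : \bar R) [set x | (x < e%:E)%E].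
  exists e => //= r; rewrite /ball_/= sub0r normrN => re.
  by rewrite lte_fin (le_lt_trans (ler_norm _)).
move=> [N _ /(_ N.+1 (leqnSn N)) /= small].
by exists N.+1%:R; split; [rewrite ltr0n|exact: ltW].
Qed.

(** Near 0 the probability of being at most u exceeds a u, and
    1 - a u <= exp (- a u). *)
Lemma density_at_0_tail (alpha a : R) : a < alpha ->
  (alpha%:E <= limf_einf
     (fun u : R => (u^-1)%:E * P [set w | (zeta w <= u)%R]) 0^'+)%E ->
  exists2 r : R, 0 < r & forall u : R, 0 < u -> u < r ->
    (P [set w | (u < zeta w)%R] <= (expR (- a * u))%:E)%E.
Proof.
move=> aalpha; rewrite /limf_einf => liminf.
have : (limf_esup (\- (fun u : R => (u^-1)%:E * P [set w | (zeta w <= u)%R]))%E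
    0^'+ < (- a)%:E)%E.
  by rewrite EFinN lteNr; apply: lt_le_trans liminf; rewrite lte_fin.
move=> /ereal_inf_ltP[_ [V V0 <-] supV].
have [r r0 rV] := at_right_ball V0.
exists r => // u u0 ur; rewrite tail_head.
have fu : (a%:E < (u^-1)%:E * P [set w | (zeta w <= u)%R])%E.
  rewrite -lteN2; apply: le_lt_trans supV; apply: ereal_sup_ubound.
  by exists u => //; apply: rV => //; rewrite add0r.
have : P [set w | (zeta w <= u)%R] \is a fin_num.
  by rewrite fin_num_measure//; exact: measurable_head.
case: (P _) fu => [p| |] // fu _.
rewrite -EFinM lte_fin mulrC ltr_pdivlMr// in fu.
rewrite -EFinB lee_fin (le_trans _ (expR_ge1Dx _))//.
by rewrite lerD2l mulNr lerN2 ltW.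
Qed.

End dominating_time.

Lemma half_pow_truncn (R : realType) (x : R) : 0 <= x ->
  2^-1 ^+ Num.truncn x <= 2 * 2 `^ (- x).
Proof.
move=> x0; rewrite -[X in _ <= X * _]powRr1// -powRD; last first.
  by apply/implyP => _; rewrite pnatr_eq0.
rewrite exprVn -powR_mulrn// -powRN ler_powR ?ler1n//.
by have := truncnS_gt x; rewrite -natr1; lra.
Qed.

Lemma exponential_prob_tail (R : realType) (alpha t : R) : 0 < alpha -> 0 <= t ->
  exponential_prob alpha [set x : R | (t%:E < x%:E)%E] =
  (expR (- alpha * t))%:E.
Proof.
move=> alpha0 t0.
have cexp : continuous (fun x : R => expR (- alpha * x)).
  move=> x; apply: continuous_comp; last exact: continuous_expR.
  exact: mulrl_continuous.
rewrite (_ : [set x | _] = `]t, +oo[%classic); last first.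
  by apply/seteqP; split=> x /=; rewrite lte_fin in_itv/= andbT.
rewrite /exponential_prob integral_itv_obnd_cbnd; last first.
  by apply/measurable_EFinP/measurable_funTS; exact: measurable_exponential_pdf.
rewrite (@ge0_continuous_FTC2y _ _ (fun x => - expR (- alpha * x)) t 0).
- by rewrite EFinN oppeK add0e.
- by move=> x _; apply: exponential_pdf_ge0; exact: ltW.
- apply: (@continuous_subspaceW R^o _ _ [set` `[0, +oo[%R]).
    by apply: subset_itvr; rewrite bnd_simp.
  exact: within_continuous_exponential_pdf.
- rewrite -oppr0; apply: cvgN.
  rewrite (_ : (fun x => expR (- alpha * x)) =
               (fun z => expR (- z)) \o (fun z => alpha * z)); last first.
    by apply: eq_fun => x; rewrite mulNr.
  apply: (@cvg_comp _ _ _ _ _ _ (pinfty_nbhs R)); last exact: cvgr_expR.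
  exact: gt0_cvgMry.
- by move=> x _; exact: ex_derive.
- by apply: cvgN; apply/cvg_at_right_filter; exact: cexp.
- move=> x; rewrite in_itv/= andbT => tx; apply: derive1_exponential_pdf.
  by rewrite in_itv/= andbT (le_lt_trans t0).
Qed.

Section meeting_time_tails.
Context (R : realType) (d : nat) (discrete : bool).
Context (Q : forall m, R.-pker (config R m d) ~> (path_space R m d)).
Context (Z : forall m (z : config R m d), process discrete (Q m) z).
Hypothesis d_gt0 : (0 < d)%N.
Hypothesis Q_consistent : dimension_consistent Q.

Lemma tail_half (M : R) : 0 < M -> pair_tail_le Z M 2^-1 ->
  forall m (z : config R m d) (i j : 'I_m), i != j ->
  forall t : R, 0 <= t ->
  (prob (Z z) [set w | t%:E < meeting_time (Z z) i j w] <=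
   (2 * 2 `^ (- (t / M)))%:E)%E.
Proof.
move=> M0 tail m z i j ij t t0.
have h0 : 0 <= 2^-1 :> R by rewrite invr_ge0.
have h1 : 2^-1 < 1 :> R by rewrite invf_lt1// ltr1n.
apply: le_trans (tail_geometric d_gt0 Q_consistent M0 h0 h1 tail z ij t0) _.
by rewrite lee_fin half_pow_truncn// divr_ge0// ltW.
Qed.

(** For a < alpha cut the interval from 0 to t into n.+1 delays of length u; the
    bounds exp (- a u) multiply to exp (- a t), for which n.+1 only has to be large
    enough for u < r. *)
Lemma tail_rate (alpha : R) : 0 < alpha ->
  (forall a, a < alpha -> exists2 r : R, 0 < r &
    forall u, 0 < u -> u < r -> pair_tail_le Z u (expR (- a * u))) ->
  forall m (z : config R m d) (i j : 'I_m), i != j ->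
  forall t : R, 0 <= t ->
  (prob (Z z) [set w | t%:E < meeting_time (Z z) i j w] <=
   (expR (- alpha * t))%:E)%E.
Proof.
move=> alpha0 tail m z i j ij t t0.
have mtau : measurable [set w | (t%:E < meeting_time (Z z) i j w)%E].
  by apply: (filt_measurable t0); exact: meeting_time_measurable.
have [->|tN0] := eqVneq t 0.
  rewrite mulr0 expR0; apply: probability_le1.
  by apply: (filt_measurable (lexx 0)); exact: meeting_time_measurable.
have {tN0}t_gt0 : 0 < t by rewrite lt_neqAle eq_sym tN0.
have bound a : 0 < a -> a < alpha ->
    (prob (Z z) [set w | t%:E < meeting_time (Z z) i j w] <=
     (expR (- a * t))%:E)%E.
  move=> a0 aalpha; have [r r0 rP] := tail a aalpha.
  have [n] := ltr_add_invr (divr_gt0 r0 t_gt0); rewrite add0r => nr.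
  pose u := t / n.+1%:R.
  have u0 : 0 < u by rewrite divr_gt0.
  have ur : u < r by rewrite /u mulrC -ltr_pdivlMr.
  have c1 : expR (- a * u) < 1 by rewrite expR_lt1 mulNr oppr_lt0 mulr_gt0.
  have := tail_geometric d_gt0 Q_consistent u0 (expR_ge0 _) c1 (rP u u0 ur) z ij t0.
  have -> : t / u = n.+1%:R by rewrite /u invf_div mulrCA divff ?mulr1// gt_eqF.
  rewrite natrK -expRM_natl (_ : _ * (- a * u) = - a * t)//.
  by rewrite /u; field.
have : prob (Z z) [set w | (t%:E < meeting_time (Z z) i j w)%E] \is a fin_num.
  by rewrite fin_num_measure.
case: (prob _ _) bound => [p| |] // bound _; rewrite lee_fin.
have [p0|p0] := leP p 0; first exact: le_trans p0 (expR_ge0 _).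
rewrite -[p]lnK ?posrE// ler_expR leNgt; apply/negP => plt.
(* Were the bound false at alpha, then b < alpha; but, by the choice of b,
   it fails at every rate above b, such as the midpoint of b and alpha. *)
pose b := Num.max 0 (- ln p / t).
have balpha : b < alpha.
  rewrite /b gt_max alpha0/= ltr_pdivrMr//; lra.
have b0 : 0 <= b by rewrite /b le_max lexx.
have bp : - ln p <= b * t by rewrite -ler_pdivrMr// /b le_max lexx orbT.
have := bound ((b + alpha) / 2) _ _; rewrite lee_fin -[X in X <= _]lnK ?posrE//.
rewrite ler_expR => /(_ _ _)/wrap[]; [lra|lra|].
have : b * t < (b + alpha) / 2 * t by rewrite ltr_pM2r//; lra.
lra.
Qed.

End meeting_time_tails.

(** * Evaluation at a random time *)

Section evaluation.
Context (R : realType) (m d : nat).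

Let grid (n : nat) (s : R) : R := (Num.truncn (s * n.+1%:R)).+1%:R / n.+1%:R.

Let grid_ge0 n s : 0 <= grid n s.
Proof. by rewrite divr_ge0. Qed.

Let grid_itv n s : 0 <= s -> s < grid n s /\ grid n s <= s + n.+1%:R^-1.
Proof.
move=> s0; have sn0 : 0 <= s * n.+1%:R by rewrite mulr_ge0.
have n0 : 0 < n.+1%:R :> R by rewrite ltr0n.
split; first by rewrite /grid ltr_pdivlMr// truncnS_gt.
rewrite /grid -natr1 mulrDl mul1r lerD2r ler_pdivrMr//.
by rewrite truncn_le.
Qed.

(** The value of a path at a time is not jointly measurable in the two on all of
    path space.  It is for right-continuous paths, where it is the limit of the
    values at the next points of ever finer grids; the upper limit extends this
    to a measurable function of all pairs. *)
Definition evaluate (p : R * path_space R m d) : config R m d :=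
  fun i => \row_k fine (limn_esup (fun n => (p.2 (grid n p.1) i ord0 k)%:E)).

Lemma evaluateE (s : R) (w : path_space R m d) : 0 <= s ->
  right_continuous_path w -> evaluate (s, w) = w s.
Proof.
move=> s0 wrc; apply/funext => i; apply/rowP => k; rewrite mxE /=.
have cvgk : (fun r => (w r i : 'rV[R]_d) ord0 k) @ s^'+ --> (w s i : 'rV[R]_d) ord0 k.
  have h := @coord_continuous R 1 d ord0 k (w s i).
  exact: cvg_comp (wrc i s s0) h.
suff cvgn : (fun n => (w (grid n s) i ord0 k)%:E) @ \oo --> (w s i ord0 k)%:E.
  by rewrite (cvg_limn_einf_sup cvgn).2.
apply/fine_cvgP; split; first exact: nearW.
apply/cvgrPdist_lt => e e0.
have /at_right_ball[c c0 cP] : \forall r \near s^'+,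
    `|w s i ord0 k - w r i ord0 k| < e by have /cvgrPdist_lt := cvgk; exact.
have [N] := ltr_add_invr c0; rewrite add0r => Nc.
exists N => // n /= Nn; have [sg gs] := grid_itv n s0.
apply: cP => //; apply: le_lt_trans gs _; rewrite ltrD2l.
by apply: le_lt_trans Nc; rewrite lef_pV2 ?posrE ?ltr0n// ler_nat.
Qed.

Lemma measurable_evaluate : measurable_fun setT evaluate.
Proof.
apply: measurable_to_config => i k; apply: (eq_measurable_fun (fun p : R * path_space R m d =>
    fine (limn_esup (fun n => (p.2 (grid n p.1) i ord0 k)%:E)))).
  by move=> p _; rewrite mxE.
apply: measurableT_comp; first exact: fine_measurable.
apply: measurable_fun_limn_esup => n.
apply/measurable_EFinP.
pose E (l : nat) := [set p : R * path_space R m d |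
  Num.truncn (p.1 * n.+1%:R) = l].
have mle (l : nat) : measurable [set p : R * path_space R m d |
    (Num.truncn (p.1 * n.+1%:R) <= l)%N].
  have -> : [set p : R * path_space R m d |
      (Num.truncn (p.1 * n.+1%:R) <= l)%N] =
      fst @^-1` `]-oo, (l.+1%:R / n.+1%:R)[%classic.
    apply/seteqP; split=> p /=; rewrite in_itv/= truncn_le_nat ltr_pdivlMr//.
  have := @measurable_fst _ _ (R : measurableType _) (path_space R m d)
    measurableT _ (measurable_itv `]-oo, (l.+1%:R / n.+1%:R)[).
  by rewrite setTI; exact.
have mE l : measurable (E l).
  case: l => [|l].
    rewrite (_ : E 0%N = [set p | (Num.truncn (p.1 * n.+1%:R) <= 0)%N])//.
    by apply/seteqP; split=> p; rewrite /E /= leqn0 => /eqP.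
  rewrite (_ : E l.+1 = [set p | (Num.truncn (p.1 * n.+1%:R) <= l.+1)%N] `\`
    [set p | (Num.truncn (p.1 * n.+1%:R) <= l)%N]); first exact: measurableD.
  apply/seteqP; split=> p; rewrite /E /=.
    by move=> ->; split => //; apply/negP; rewrite -ltnNge.
  by case=> le1 /negP; rewrite -ltnNge => le2; apply/eqP; rewrite eqn_leq le1.
rewrite (_ : setT = \bigcup_l E l); last first.
  by apply/seteqP; split => // p _; exists (Num.truncn (p.1 * n.+1%:R)).
apply/(measurable_fun_bigcup _ mE) => l.
apply: (eq_measurable_fun (fun p : R * path_space R m d =>
    (p.2 (l.+1%:R / n.+1%:R) : config R m d) i ord0 k)).
  by move=> p; rewrite inE /E /= /grid => ->.
have g0 : 0 <= l.+1%:R / n.+1%:R :> R by rewrite divr_ge0.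
apply: measurable_funTS.
exact: (measurableT_comp (measurable_coordinate i k)
  (measurableT_comp (@measurable_at R m d _ g0)
    (@measurable_snd _ _ (R : measurableType _) (path_space R m d)))).
Qed.

End evaluation.

(** * Exchanging two points after they meet *)

Section swapping.
Context (R : realType) (m d : nat) (discrete : bool).
Context (Q : R.-pker (config R m d) ~> (path_space R m d)) (z : config R m d).
Context (Z : process discrete Q z) (i j : 'I_m).
Hypothesis Q_exchangeable : forall (x : config R m d) (A : set (path_space R m d)),
  measurable A ->
  Q x [set w | A (fun t l => w t (tperm i j l))] = Q (fun l => x (tperm i j l)) A.

Local Notation Omega := (Defs.space Z).
Local Notation P := (fs_prob (Defs.space Z)).
Local Notation tau := (meeting_time Z i j).

Let swap (w : path_space R m d) : path_space R m d :=
  fun t l => w t (tperm i j l).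

Let measurable_swap : measurable_fun setT swap.
Proof.
apply: measurable_to_path => t t0; apply: measurable_to_config => l k.
exact: (measurableT_comp (measurable_coordinate _ k) (@measurable_at R m d t t0)).
Qed.

Let tau_ge0 w : (0 <= tau w)%E.
Proof. by rewrite meeting_timeE; exact: first_zero_ge0. Qed.

Let tau_attained (w : Omega) : (tau w < +oo)%E ->
  [/\ 0 <= fine (tau w), (fine (tau w))%:E = tau w &
      traj (fine (tau w)) w i = traj (fine (tau w)) w j].
Proof.
move=> tau_fin; have tauE : (fine (tau w))%:E = tau w.
  by rewrite fineK// ge0_fin_numE.
have : (first_zero (gap (fun t => traj t w) i j) <= (fine (tau w))%:E)%E.
  by rewrite tauE meeting_timeE.
move=> /(first_zero_attained (gap_ge0 _ i j)
  (@gap_right_continuous _ _ _ _ i j (@traj_rc _ _ _ _ _ _ Z w))).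
rewrite -/(meet _ i j) -meeting_timeE => -[s [s0 _ tau_s /eqP]].
by rewrite normr_eq0 subr_eq0 tau_s /= => /eqP.
Qed.

Let meeting_time_valued : time_valued discrete tau.
Proof.
move=> w; have [tau_fin|] := ltP (tau w) +oo%E; last first.
  by rewrite leye_eq => /eqP; left.
right; have [t0 tauE _] := tau_attained tau_fin.
exists (fine (tau w)); last by rewrite tauE.
rewrite /time_set.
have [dT|/negP/negbTE dF] := pselect (is_true discrete); last by rewrite ifF.
rewrite ifT//.
have : (tau w <= (fine (tau w))%:E)%E by rewrite tauE.
by move=> /(meeting_time_floor dT t0) [n [_ -> _]]; exists n.
Qed.

(** It suffices to consider half-lines, which generate the Borel sets. *)
Let before_meeting (B : set R) : measurable B ->
  before tau [set w | (tau w < +oo)%E /\ B (fine (tau w))].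
Proof.
move=> mB; suff fB t : 0 <= t ->
    filt t ([set w | (tau w < +oo)%E /\ B (fine (tau w))] `&`
            [set w | (tau w <= t%:E)%E]).
  split=> //.
  rewrite (_ : [set w | _] = \bigcup_n
    ([set w | (tau w < +oo)%E /\ B (fine (tau w))] `&`
     [set w | (tau w <= n%:R%:E)%E])).
    by apply: bigcupT_measurable => n; apply: (filt_measurable (ler0n R n)); exact: fB.
  apply/seteqP; split=> w; last by move=> [n _ []].
  move=> [tau_fin Bw]; exists (Num.truncn (fine (tau w))).+1 => //; split => //=.
  by have [_ <- _] := tau_attained tau_fin; rewrite lee_fin ltW// truncnS_gt.
move=> t0.
have sF := @filt_sigma_algebra R Omega t t0.
have ft (a : R) : filt t [set w | (tau w <= (Num.min a t)%:E)%E].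
  have [a0|a0] := leP 0 a.
    have at0 : 0 <= Num.min a t by rewrite le_min a0.
    apply: (filt_nondecreasing at0); first by rewrite ge_min lexx orbT.
    by have [_] := meeting_time_optional Z i j; exact.
  rewrite (_ : [set w | _] = set0); first exact: (sigma_set0 sF).
  rewrite -subset0 => w /=; apply/negP; rewrite -ltNge.
  by apply: lt_le_trans (tau_ge0 w); rewrite lte_fin gt_min a0.
have ftt : filt t [set w | (tau w <= t%:E)%E] by have := ft t; rewrite minxx.
pose C := [set B' : set R | filt t ([set w | (tau w < +oo)%E /\ B' (fine (tau w))]
   `&` [set w | (tau w <= t%:E)%E])].
have tau_fint w : (tau w <= t%:E)%E -> (tau w < +oo)%E.
  by move=> /le_lt_trans; apply; exact: ltry.
suff : (@RGenOInfty.G R).-sigma.-measurable `<=` C.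
  by apply; rewrite -RGenOInfty.measurableE.
apply: smallest_sub; last first.
  move=> _ [a ->]; rewrite /C /=.
  rewrite (_ : _ `&` _ = [set w | (tau w <= t%:E)%E] `&`
      ~` [set w | (tau w <= (Num.min a t)%:E)%E]).
    exact: (sigma_setI sF ftt (sigma_setC sF (ft a))).
  apply/seteqP; split=> w /= [h1 h2].
    case: h1 => tau_fin; rewrite in_itv/= andbT => atau; split => //.
    apply/negP; rewrite -ltNge; have [_ <- _] := tau_attained tau_fin.
    by rewrite lte_fin gt_min atau.
  have tau_fin := tau_fint w h1.
  have [_ tauE _] := tau_attained tau_fin.
  split => //; split => //; rewrite in_itv/= andbT ltNge; apply/negP => taua.
  apply: h2; rewrite -tauE lee_fin le_min taua/=.
  by rewrite -lee_fin tauE.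
split=> [|A CA|A CA]; rewrite /C /=.
- rewrite (_ : _ `&` _ = set0); first exact: (sigma_set0 sF).
  by rewrite -subset0 => w [[]].
- rewrite (_ : _ `&` _ = [set w | (tau w <= t%:E)%E] `&`
      ~` ([set w | (tau w < +oo)%E /\ A (fine (tau w))]
   `&` [set w | (tau w <= t%:E)%E])).
    exact: (sigma_setI sF ftt (sigma_setC sF CA)).
  apply/seteqP; split=> w /= [h1 h2].
    by split => // -[[_ ?] _]; case: h1 => _ [].
  split=> //; split; first exact: tau_fint.
  by split => // Aw; apply: h2; split => //; split => //; exact: tau_fint.
- rewrite (_ : _ `&` _ = \bigcup_n ([set w | (tau w < +oo)%E /\ A n (fine (tau w))]
   `&` [set w | (tau w <= t%:E)%E])); first exact: (sigma_bigcup sF).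
  apply/seteqP; split=> w /=.
    by move=> [[h1 [n _ h2]] h3]; exists n.
  by move=> [n _ [[h1 h2] h3]]; split => //; split => //; exists n.
Qed.

Let measurable_tau_fin : measurable [set w | (tau w < +oo)%E].
Proof.
have [+ _] := before_meeting (@measurableT _ R); congr measurable.
by apply/seteqP; split=> w //= -[].
Qed.

Let fine_tau_ge0 w : 0 <= fine (tau w).
Proof. by apply: fine_ge0; exact: tau_ge0. Qed.

Let measurable_fine_tau : measurable_fun setT (fine \o tau).
Proof.
rewrite -(setUv [set w | (tau w < +oo)%E]); apply/measurable_funU => //.
  exact: measurableC.
split; first by move=> _ B mB; have [] := before_meeting mB.
apply: (@eq_measurable_fun _ _ Omega R _ (fun=> 0)); last exact: measurable_cst.
by move=> w; rewrite inE /= => /negP; rewrite -leNgt leye_eq => /eqP ->.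
Qed.

Let theta (w : Omega) : path_space R m d :=
  fun r => traj (fine (tau w) + r) w.

Let theta_rc (w : Omega) : right_continuous_path (theta w).
Proof.
exact: (right_continuous_shift (fine_tau_ge0 w) (@traj_rc _ _ _ _ _ _ Z w)).
Qed.

Let measurable_theta : measurable_fun setT theta.
Proof.
apply: measurable_to_path => r r0.
apply: (eq_measurable_fun (fun w : Omega =>
    evaluate (fine (tau w) + r, (fun t => traj t w) : path_space R m d))).
  move=> w _; rewrite evaluateE//; first exact: addr_ge0.
  exact: traj_rc.
apply: (measurableT_comp (@measurable_evaluate R m d)).
apply/measurable_fun_pairP; split; last exact: (measurable_traj Z).
exact: measurable_funD measurable_fine_tau (measurable_cst _).
Qed.

Let joint (f : path_space R m d -> path_space R m d) (w : Omega) :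
  R * path_space R m d := (fine (tau w), f (theta w)).

Let measurable_joint f : measurable_fun setT f -> measurable_fun setT (joint f).
Proof.
move=> mf; apply/measurable_fun_pairP; split; first exact: measurable_fine_tau.
exact: measurableT_comp mf measurable_theta.
Qed.

(** The two points are at the same place when they meet, so exchanging their labels
    there does not change the starting point of the path that follows.  By
    exchangeability it does not change the law of that path, even given the
    meeting time. *)
Let joint_law_swap (C : set (R * path_space R m d)) : measurable C ->
  P ([set w | C (joint id w)] `&` [set w | (tau w < +oo)%E]) =
  P ([set w | C (joint swap w)] `&` [set w | (tau w < +oo)%E]).
Proof.
move=> mC.
have law (f : path_space R m d -> path_space R m d) : measurable_fun setT f ->
    exists mu : {measure set (R * path_space R m d) -> \bar R}, forall C',
      mu C' = P ([set w | C' (joint f w)] `&` [set w | (tau w < +oo)%E]).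
  move=> mf; unshelve eexists
    (pushforward (mrestr P measurable_tau_fin) (joint f)); last by [].
  exact: measurable_joint.
have mid : measurable_fun setT (@id (path_space R m d)) by exact: measurable_id.
pose G := [set B `*` A | B in @measurable _ R & A in @measurable _ (path_space R m d)].
have [mu1 mu1E] := law id mid; have [mu2 mu2E] := law swap measurable_swap.
rewrite -mu1E -mu2E.
apply: (@measure_unique _ _ _ G (fun=> setT) _ _ _ _ mu1 mu2 _ _ C mC).
- exact: measurable_prod_measurableType.
- move=> _ _ [B1 mB1 [A1 mA1 <-]] [B2 mB2 [A2 mA2 <-]]; rewrite -setXI.
  exists (B1 `&` B2); first exact: measurableI.
  by exists (A1 `&` A2) => //; exact: measurableI.
- by move=> _; exists setT => //; exists setT => //; rewrite setXTT.
- by rewrite bigcup_const//; exists 0%N.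
- move=> _ [B mB [A mA <-]]; rewrite mu1E mu2E.
  pose E := [set w | (tau w < +oo)%E /\ B (fine (tau w))].
  have muE f : P ([set w | (B `*` A) (joint f w)] `&` [set w | (tau w < +oo)%E]) =
      P (E `&` [set w | (tau w < +oo)%E] `&` [set w | (f @^-1` A) (theta w)]).
    by congr (P _); apply/seteqP; split=> w; rewrite /E /joint /=; tauto.
  have mswapA : measurable (swap @^-1` A).
    by have := measurable_swap measurableT mA; rewrite setTI.
  have strong := traj_strong_Markov (meeting_time_optional Z i j)
    meeting_time_valued (before_meeting mB).
  transitivity (P (E `&` [set w | (tau w < +oo)%E] `&` [set w | A (theta w)])).
    exact: (muE id).
  rewrite [LHS](strong A mA); symmetry.
  transitivity (P (E `&` [set w | (tau w < +oo)%E] `&`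
      [set w | (swap @^-1` A) (theta w)])); first exact: (muE swap).
  rewrite [LHS](strong _ mswapA); apply: eq_integral => w.
  rewrite inE => -[_ /= tau_fin].
  have [_ _ meet_w] := tau_attained tau_fin.
  rewrite [LHS]Q_exchangeable//; congr (Q _ A); apply/funext => l.
  by case: tpermP => // ->.
- move=> _; apply: (@le_lt_trans _ _ 1%E); last exact: ltry.
  rewrite mu1E (_ : _ `&` _ = [set w | (tau w < +oo)%E]) ?probability_le1//.
  by apply/seteqP; split=> w //= [].
Qed.

(** The state at time t is the value of the path after the meeting at the remaining
    time, hence a function of the meeting time and that path. *)
Lemma swap_after_meeting (t : R) (B : set (config R m d)) : 0 <= t ->
  measurable B ->
  P ([set w | (tau w <= t%:E)%E] `&` [set w | B (traj t w)]) =
  P ([set w | (tau w <= t%:E)%E] `&`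
     [set w | B (fun l => traj t w (tperm i j l))]).
Proof.
move=> t0 mB.
pose C := [set p : R * path_space R m d | p.1 <= t] `&`
  [set p : R * path_space R m d | B (evaluate (t - p.1, p.2))].
have mC : measurable C.
  apply: measurableI.
    rewrite (_ : [set p | _] =
        [set: R * path_space R m d] `&` fst @^-1` `]-oo, t]%classic).
      exact: (@measurable_fst _ _ (R : measurableType _) (path_space R m d)
        measurableT _ (measurable_itv `]-oo, t])).
    by rewrite setTI; apply/seteqP; split=> p /=; rewrite in_itv.
  have me : measurable_fun setT (fun p : R * path_space R m d =>
      evaluate (t - p.1, p.2)).
    apply: (measurableT_comp (@measurable_evaluate R m d)).
    apply/measurable_fun_pairP; split.
      exact: measurable_funB (measurable_cst _) measurable_fst.
    exact: measurable_snd.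
  by have := me measurableT _ mB; rewrite setTI.
have CE f (w : Omega) : right_continuous_path (f (theta w)) ->
    ([set w | C (joint f w)] `&` [set w | (tau w < +oo)%E]) w <->
    (tau w <= t%:E)%E /\ B (f (theta w) (t - fine (tau w))).
  move=> frc; split.
    move=> [[/= taut Bw] tau_fin]; have [_ <- _] := tau_attained tau_fin.
    rewrite lee_fin; split => //; rewrite evaluateE in Bw => //.
    by rewrite subr_ge0.
  move=> [taut Bw]; have tau_fin := le_lt_trans taut (ltry t).
  have tau_t : fine (tau w) <= t.
    by have [_ tauE _] := tau_attained tau_fin; rewrite -lee_fin tauE.
  by split=> //; split=> //=; rewrite evaluateE// subr_ge0.
have traj_t (w : Omega) : theta w (t - fine (tau w)) = traj t w.
  by rewrite /theta addrC subrK.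
transitivity (P ([set w | C (joint id w)] `&` [set w | (tau w < +oo)%E])).
  congr (P _); apply/seteqP; split=> w; rewrite CE //= traj_t; tauto.
rewrite joint_law_swap//; congr (P _).
have swap_rc w : right_continuous_path (swap (theta w)).
  by move=> l s s0; exact: (@theta_rc w (tperm i j l) s s0).
apply/seteqP; split=> w; rewrite CE// /swap traj_t //=; tauto.
Qed.

End swapping.

(** * Nearly invariant laws on the symmetric group *)

Section nearly_invariant.
Context (R : realType) (m : nat) (p : {set 'S_m} -> R) (q : 'S_m -> R) (e : R).
Hypothesis p_additive : forall A, p A = \sum_(g in A) q g.
Hypothesis p_total : \sum_g q g = 1.
Hypothesis e_ge0 : 0 <= e.
Hypothesis p_tperm : forall (A : {set 'S_m}) (i j : 'I_m), i != j ->
  p A <= p (A :* tperm i j)%g + e.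

(** If g moves i = k, one transposition corrects this and leaves a permutation of
    the first k points; so g is a product of at most k transpositions. *)
Lemma nearly_invariant_on (k : nat) (g : 'S_m) : (k <= m)%N ->
  perm_on [set i : 'I_m | (i < k)%N] g ->
  forall A : {set 'S_m}, p A <= p (A :* g)%g + k%:R * e.
Proof.
elim: k g => [|k IH] g km gk A.
  have -> : g = 1%g.
    by apply/permP => i; rewrite perm1; apply: (out_perm gk); rewrite inE.
  by rewrite mulg1 mul0r addr0.
pose i := Ordinal km.
have gfix (l : 'I_m) : (k < l)%N -> g l = l.
  by move=> kl; apply: (out_perm gk); rewrite inE -leqNgt.
have [gi|gi] := eqVneq (g i) i.
  have gk' : perm_on [set i : 'I_m | (i < k)%N] g.
    apply/fintype.subsetP => l; rewrite !inE => gl; rewrite ltn_neqAle.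
    have := fintype.subsetP gk l; rewrite !inE => /(_ gl) lk; rewrite -ltnS lk andbT.
    by apply: contra gl => /eqP lk'; rewrite (_ : l = i) ?gi//; exact: val_inj.
  apply: (le_trans (IH g (ltnW km) gk' A)); rewrite lerD2l ler_wpM2r//.
  by rewrite ler_nat.
pose h := (g * tperm i (g i))%g.
have hk : perm_on [set i : 'I_m | (i < k)%N] h.
  apply/fintype.subsetP => l; rewrite !inE => hl; rewrite ltnNge.
  apply: contra hl; rewrite leq_eqVlt => /orP[/eqP kl|kl]; rewrite permM.
    by rewrite (_ : l = i) ?tpermR//; exact: val_inj.
  rewrite (gfix l kl) tpermD//.
    by rewrite -val_eqE/= neq_ltn kl.
  apply/eqP => gil; have il : i = l by apply: (@perm_inj _ g); rewrite gil gfix.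
  by move: kl; rewrite -il ltnn.
have -> : (A :* g = (A :* h) :* tperm i (g i))%g.
  by rewrite -rcosetM /h -mulgA tperm2 mulg1.
have hA := IH h (ltnW km) hk A.
have ti : p (A :* h)%g <= p ((A :* h) :* tperm i (g i))%g + e.
  by apply: p_tperm; rewrite eq_sym.
by rewrite -natr1 mulrDl mul1r; lra.
Qed.

(** The translates of p are all close to p, and their average is uniform. *)
Lemma nearly_uniform (A : {set 'S_m}) :
  `|p A - #|A|%:R / #|{: 'S_m}|%:R| <= m%:R * e.
Proof.
have inv g B : p B <= p (B :* g)%g + m%:R * e.
  apply: nearly_invariant_on => //; apply/fintype.subsetP => i _.
  by rewrite inE ltn_ord.
have inv' g : p (A :* g)%g <= p A + m%:R * e.
  by have := inv g^-1%g (A :* g)%g; rewrite -rcosetM mulgV mulg1.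
set N := #|{: 'S_m}|.
have N0 : 0 < N%:R :> R by rewrite ltr0n; apply/card_gt0P; exists 1%g.
have avg : \sum_g p (A :* g)%g = #|A|%:R.
  transitivity (\sum_g \sum_(a in A) q (a * g)%g).
    apply: eq_bigr => g _; rewrite p_additive.
    rewrite (reindex (fun a => (a * g)%g)) /=; last first.
      by exists (fun a => (a * g^-1)%g) => a _; rewrite ?mulgK ?mulgKV.
    by apply: eq_bigl => a; rewrite mem_rcoset mulgK.
  rewrite exchange_big /= -sum1_card natr_sum; apply: eq_bigr => a _.
  by rewrite (reindex_inj (mulgI a^-1%g)) /= -[RHS]p_total; apply: eq_bigr => g _;
    rewrite mulKVg.
have sumc (c : R) : \sum_(g : 'S_m) c = N%:R * c.
  by rewrite sumr_const /N mulr_natl.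
have lower : N%:R * (p A - m%:R * e) <= #|A|%:R.
  by rewrite -avg -sumc; apply: ler_sum => g _; rewrite lerBlDr; exact: inv.
have upper : #|A|%:R <= N%:R * (p A + m%:R * e).
  by rewrite -avg -sumc; apply: ler_sum => g _; exact: inv'.
have divN : #|A|%:R = N%:R * (#|A|%:R / N%:R) :> R.
  by rewrite mulrC divfK// gt_eqF.
rewrite divN ler_pM2l// in lower; rewrite divN ler_pM2l// in upper.
rewrite ler_norml; apply/andP; split; lra.
Qed.

End nearly_invariant.

(** * The tie-breaking variables *)

Section marks.
Context (R : realType) (dU : measure_display) (TU : measurableType dU).
Context (PU : probability TU R) (U : nat -> {RV PU >-> R}).
Hypothesis iidU : iid_uniform U.

(** Configurations in dimension 1 carry the product sigma-algebra on families of m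
    real numbers. *)
Definition marks (m : nat) (u : TU) : config R m 1 := fun i => const_mx (U i u).

Lemma measurable_marks m : measurable_fun setT (@marks m).
Proof.
apply: measurable_to_config => i k.
apply: (eq_measurable_fun (U i)); first by move=> u _; rewrite mxE.
exact: measurable_funPT.
Qed.

Lemma prob_box m (B : 'I_m -> set R) : (forall i, measurable (B i)) ->
  PU [set u | forall i, B i (U i u)] =
  (\prod_(i < m) uniform_prob (@ltr01 R) (B i))%E.
Proof.
move=> mB; pose A k := if insub k is Some i then B i else setT : set R.
have mA k : measurable (A k) by rewrite /A; case: insub.
have AE (i : 'I_m) : A i = B i by rewrite /A valK.
have -> : [set u | forall i, B i (U i u)] =
    \bigcap_(k in [set k | (k < m)%N]) (U k @^-1` A k).
  apply/seteqP; split=> u /=.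
    by move=> h k km; have := h (Ordinal km); rewrite -AE.
  by move=> h i; rewrite -AE; exact: (h i (ltn_ord i)).
rewrite (iidU.2 m A mA); apply: eq_bigr => i _.
by rewrite -(iidU.1 i (B i) (mB i)) AE.
Qed.

(** On boxes, both laws are given by the same product up to the order of its
    factors. *)
Lemma marks_exchangeable m (s : 'S_m) (D : set (config R m 1)) : measurable D ->
  PU [set u | D (fun i => marks u (s i))] = PU [set u | D (@marks m u)].
Proof.
move=> mD.
pose marks_s (u : TU) : config R m 1 := fun i => marks u (s i).
have mmarks_s : measurable_fun setT marks_s.
  apply: measurable_to_config => i k.
  exact: (measurableT_comp (measurable_coordinate (s i) k) (@measurable_marks m)).
pose mu1 := distribution PU (mfun_Sub (mem_set mmarks_s)).
pose mu2 := distribution PU (mfun_Sub (mem_set (@measurable_marks m))).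
suff : mu1 D = mu2 D by [].
pose box (B : 'I_m -> set R) : set (config R m 1) :=
  [set x | forall i, B i (x i ord0 ord0)].
pose G := [set box B | B in [set B | forall i, measurable (B i)]].
have mbox B : (forall i, measurable (B i)) -> measurable (box B).
  move=> mB; rewrite (_ : box B = \bigcap_(i in [set: 'I_m])
      ((fun x : config R m 1 => x i ord0 ord0) @^-1` B i)).
    apply: fin_bigcap_measurable => // i _.
    by have := @measurable_coordinate R m 1 i ord0 measurableT _ (mB i); rewrite setTI.
  by apply/seteqP; split=> x /= h i => [_|]; exact: h.
apply: (@measure_unique _ _ _ G (fun=> setT) _ _ _ _ mu1 mu2 _ _ D mD).
- apply/seteqP; split.
    apply: smallest_sub; first exact: smallest_sigma_algebra.
    move=> _ [i [k [B mB ->]]]; apply: sub_sigma_algebra.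
    exists (fun l => if l == i then B else setT); first by move=> l /=; case: ifP.
    apply/seteqP; split=> x /=; rewrite /box /= (ord1 k).
      by move=> /(_ i); rewrite eqxx.
    by move=> Bx l; case: eqP => // ->.
  apply: smallest_sub; first exact: sigma_algebra_measurable.
  by move=> _ [B mB <-]; exact: mbox.
- move=> _ _ [B1 mB1 <-] [B2 mB2 <-]; exists (fun i => B1 i `&` B2 i).
    by move=> i; exact: measurableI.
  apply/seteqP; split=> x; rewrite /box /=.
    by move=> h; split=> i; have [] := h i.
  by move=> [h1 h2] i; split.
- move=> _; exists (fun=> setT) => //.
  by apply/seteqP; split.
- by rewrite bigcup_const//; exists 0%N.
- move=> _ [B mB <-].
  have mBs i : measurable (B ((s^-1)%g i)) by exact: mB.
  transitivity (PU [set u | forall i, B ((s^-1)%g i) (U i u)]).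
    congr (PU _); apply/seteqP; split=> u /=; rewrite /marks_s /marks /=.
      by move=> h i; have := h ((s^-1)%g i); rewrite mxE permKV.
    by move=> h i; have := h (s i); rewrite mxE permK.
  transitivity (PU [set u | forall i : 'I_m, B i (U i u)]); last first.
    congr (PU _); apply/seteqP; split=> u /=; rewrite /marks /=.
      by move=> h i; rewrite mxE; exact: h.
    by move=> h i; have := h i; rewrite mxE.
  rewrite (prob_box mBs) (prob_box mB) [LHS](reindex_inj (@perm_inj _ s)) /=.
  by apply: eq_bigr => i _; rewrite permK.
- move=> _; apply: (@le_lt_trans _ _ 1%E); last exact: ltry.
  by rewrite probability_le1.
Qed.

(** The sections of the diagonal are points, which the uniform law does not
    charge. *)
Lemma marks_distinct (i j : nat) : i != j -> PU [set u | U i u = U j u] = 0%E.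
Proof.
move=> ij.
pose V (u : TU) := (U i u, U j u).
have mV : measurable_fun setT V.
  by apply/measurable_fun_pairP; split; exact: measurable_funPT.
pose nu : {measure set (R * R) -> \bar R} := distribution PU (mfun_Sub (mem_set mV)).
pose mui := distribution PU (U i); pose muj := distribution PU (U j).
have nuE : forall X : set (R * R), measurable X -> (mui \x muj)%E X = nu X.
  apply: (@product_measure_unique _ _ R R R mui muj nu) => A B mA mB.
  pose n := (maxn i j).+1.
  have ltin : (i < n)%N by rewrite ltnS leq_maxl.
  have ltjn : (j < n)%N by rewrite ltnS leq_maxr.
  pose C (k : 'I_n) : set R := if k == i :> nat then A else
    if k == j :> nat then B else setT.
  have mC k : measurable (C k) by rewrite /C; case: ifP => //; case: ifP.
  have Cj : C (Ordinal ltjn) = B by rewrite /C /= eq_sym (negbTE ij) eqxx.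
  have Ci : C (Ordinal ltin) = A by rewrite /C /= eqxx.
  transitivity (PU [set u | forall k : 'I_n, C k (U k u)]).
    congr (PU _); apply/seteqP; split=> u /=.
      move=> [Au Bu] k; rewrite /C; case: eqP => [->//|_].
      by case: eqP => [->//|_].
    move=> h; split; first by have := h (Ordinal ltin); rewrite Ci.
    by have := h (Ordinal ltjn); rewrite Cj.
  rewrite (prob_box mC) (bigD1 (Ordinal ltin)) //= Ci.
  rewrite -(iidU.1 i A mA); congr (_ * _)%E.
  rewrite (bigD1 (Ordinal ltjn)) /=; last by rewrite -val_eqE /= eq_sym.
  rewrite Cj -(iidU.1 j B mB) big1 ?mule1// => k /andP[ki kj].
  rewrite /C ifN; last by rewrite -val_eqE in ki.
  rewrite ifN; last by rewrite -val_eqE in kj.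
  by rewrite -(iidU.1 i setT)//; exact: probability_setT.
pose D := [set p : R * R | p.1 = p.2].
have mD : measurable D.
  have := @measurable_fun_eqr _ (R * R)%type R setT fst snd measurable_fst
    measurable_snd measurableT [set true] Logic.I.
  rewrite setTI (_ : _ @^-1` _ = D)//.
  by apply/seteqP; split=> p /= /eqP.
have -> : PU [set u | U i u = U j u] = (mui \x muj)%E D by rewrite nuE.
rewrite /product_measure1 integral0_eq// => x _ /=.
rewrite (_ : xsection D x = [set x]); last first.
  by apply/seteqP; split=> y; rewrite /xsection /= inE /D /= => ->.
rewrite /muj (iidU.1 j)//.
have /null_content_dominatesP := @dominates_uniform_prob R 0 1 ltr01.
by apply; [exact: measurable_set1|exact: lebesgue_measure_set1].
Qed.

End marks.

(** * Rank-to-index permutations *)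

Section ranks.
Context (R : realType) (m : nat) (x u : 'I_m -> R).

Definition lex_lt (a b : 'I_m) : bool :=
  (x a < x b) || ((x a == x b) && (u a < u b)).

Lemma rank_to_indexP (g : 'S_m) : rank_to_index x u g <->
  forall i j : 'I_m, (i < j)%N -> lex_lt (g i) (g j).
Proof.
split=> h i j ij; have := h i j ij; rewrite /lex_lt.
  by case=> [->//|[-> ->]]; rewrite eqxx orbT.
by case/orP => [|/andP[/eqP]]; [left|right].
Qed.

Lemma lex_lt_irr a : lex_lt a a = false.
Proof. by rewrite /lex_lt !ltxx andbF. Qed.

Lemma lex_lt_trans b a c : lex_lt a b -> lex_lt b c -> lex_lt a c.
Proof.
rewrite /lex_lt => /orP[ab|/andP[/eqP ab uab]] /orP[bc|/andP[/eqP bc ubc]].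
- by rewrite (lt_trans ab bc).
- by rewrite -bc ab.
- by rewrite ab bc.
- by rewrite ab bc eqxx (lt_trans uab ubc) orbT.
Qed.

(** A permutation that sorts the pairs is inverse to this map, which gives both its
    uniqueness and its construction. *)
Definition position (a : 'I_m) : nat := #|[pred b | lex_lt b a]|.

Lemma position_lt a b : lex_lt a b -> (position a < position b)%N.
Proof.
move=> ab; apply: proper_card; apply/fintype.properP; split.
  by apply/fintype.subsetP => c; rewrite !inE => /lex_lt_trans; apply.
by exists a; rewrite !inE ?lex_lt_irr.
Qed.

Lemma position_ltn a : (position a < m)%N.
Proof.
rewrite -[X in (_ < X)%N]card_ord; apply: proper_card.
apply/fintype.properP; split; first exact/fintype.subsetP.
by exists a; rewrite // inE lex_lt_irr.
Qed.

Lemma rank_position (g : 'S_m) i : rank_to_index x u g -> position (g i) = i.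
Proof.
move=> /rank_to_indexP rg; rewrite /position -sum1_card.
rewrite (reindex_inj (@perm_inj _ g)) /=.
rewrite (eq_bigl (fun j : 'I_m => (j < i)%N)).
  by rewrite (big_ord_narrow (ltnW (ltn_ord i))) sum1_card card_ord.
move=> j; rewrite inE; have [ji|ij|/val_inj ->] := ltngtP j i.
- exact: rg.
- by apply/negbTE/negP => /(lex_lt_trans (rg _ _ ij)); rewrite lex_lt_irr.
- exact: lex_lt_irr.
Qed.

Lemma rank_unique (g h : 'S_m) :
  rank_to_index x u g -> rank_to_index x u h -> g = h.
Proof.
move=> rg rh; apply: invg_inj; apply/permP => a; apply: val_inj => /=.
by rewrite -(rank_position _ rg) -(rank_position (h^-1%g a) rh) !permKV.
Qed.

Lemma rank_exists : injective u -> exists g : 'S_m, rank_to_index x u g.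
Proof.
move=> u_inj.
have total a b : a != b -> lex_lt a b || lex_lt b a.
  move=> ab; rewrite /lex_lt; have [//|//|xab] := ltgtP (x a) (x b).
  by rewrite /= -neq_lt (inj_eq u_inj).
pose f a := Ordinal (position_ltn a).
have f_inj : injective f.
  move=> a b /(congr1 val) /= pab; apply/eqP; apply/negPn/negP => /total.
  by case/orP => /position_lt; rewrite pab ltnn.
exists (perm f_inj)^-1%g; apply/rank_to_indexP => i j ij.
set g := (perm f_inj)^-1%g.
have posg l : position (g l) = l.
  by have /(congr1 val) /= := permKV (perm f_inj) l; rewrite permE.
have /total/orP[//|/position_lt] : g i != g j.
  by apply: contraTneq ij => /perm_inj ->; rewrite ltnn.
by rewrite !posg ltnNge ltnW.
Qed.

End ranks.

Lemma rank_to_index_perm (R : realType) (m : nat) (x u : 'I_m -> R) (s g : 'S_m) :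
  rank_to_index (fun i => x (s i)) (fun i => u (s i)) g <->
  rank_to_index x u (g * s)%g.
Proof. by split=> h i j ij; have := h i j ij; rewrite !permM. Qed.


Section shuffle_event.
Context (R : realType) (m d : nat) (k : 'I_d).

Definition rank_event (g : 'S_m) : set (config R m d * config R m 1) :=
  [set p : config R m d * config R m 1 |
    rank_to_index (fun i => p.1 i ord0 k) (fun i => p.2 i ord0 ord0) g].

Lemma measurable_rank_event g : measurable (rank_event g).
Proof.
have mx i : measurable_fun setT
    (fun p : config R m d * config R m 1 => p.1 i ord0 k).
  exact: (measurableT_comp (measurable_coordinate i k) measurable_fst).
have mu i : measurable_fun setT
    (fun p : config R m d * config R m 1 => p.2 i ord0 ord0).
  exact: (measurableT_comp (measurable_coordinate i ord0) measurable_snd).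
rewrite (_ : rank_event g = \bigcap_(ij in [set ij : 'I_m * 'I_m | (ij.1 < ij.2)%N])
    [set p : config R m d * config R m 1 | lex_lt (fun i => p.1 i ord0 k) (fun i => p.2 i ord0 ord0)
       (g ij.1) (g ij.2)]).
  apply: fin_bigcap_measurable => [|[i j] _]; first exact: finite_finset.
  have ml : measurable_fun setT (fun p : config R m d * config R m 1 =>
      lex_lt (fun i => p.1 i ord0 k) (fun i => p.2 i ord0 ord0) (g i) (g j)).
    apply: measurable_or; first exact: measurable_fun_ltr.
    by apply: measurable_and; [exact: measurable_fun_eqr|exact: measurable_fun_ltr].
  by have := ml measurableT [set true] Logic.I; rewrite setTI.
apply/seteqP; split=> p.
  by move=> /rank_to_indexP h [i j] /= ij; exact: h.
by move=> h; apply/rank_to_indexP => i j ij; exact: (h (i, j)).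
Qed.

End shuffle_event.

Section swap_bound.
Context (R : realType) (m d : nat) (s : 'S_m).
Context (dO dU : measure_display) (Omega : measurableType dO)
  (TU : measurableType dU).
Context (P : probability Omega R) (PU : probability TU R).
Context (U : nat -> {RV PU >-> R}) (X : Omega -> config R m d) (e : R).
Hypothesis iidU : iid_uniform U.
Hypothesis mX : measurable_fun setT X.
Hypothesis e_ge0 : 0 <= e.
Hypothesis nearly : forall B : set (config R m d), measurable B ->
  (P [set w | B (X w)] <= P [set w | B (fun i => X w (s i))] + e%:E)%E.

Lemma measurable_sample (Y : Omega -> config R m d) (V : TU -> config R m 1)
    (D : set (config R m d * config R m 1)) : measurable_fun setT Y ->
  measurable_fun setT V -> measurable D ->
  measurable [set w : Omega * TU | D (Y w.1, V w.2)].
Proof.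
move=> mY mV mD.
have mYV : measurable_fun setT (fun w : Omega * TU => (Y w.1, V w.2)).
  apply/measurable_fun_pairP; split.
    exact: (measurableT_comp mY measurable_fst).
  exact: (measurableT_comp mV measurable_snd).
by have := mYV measurableT _ mD; rewrite setTI.
Qed.

Let Xs w : config R m d := fun i => X w (s i).

(** Relabelling the positions costs e by hypothesis, for each value of the
    tie-breaking variables; relabelling these too is free as they are
    exchangeable. *)
Lemma swap_bound (D : set (config R m d * config R m 1)) : measurable D ->
  ((P \x PU) [set w | D (X w.1, marks U w.2)] <=
   (P \x PU) [set w | D ((fun i => X w.1 (s i)), (fun i => marks U w.2 (s i)))]
   + e%:E)%E.
Proof.
move=> mD.
have mXs : measurable_fun setT Xs.
  apply: measurable_to_config => i l.
  exact: (measurableT_comp (measurable_coordinate (s i) l) mX).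
have mV := @measurable_marks R dU TU PU U m.
have mVs : measurable_fun setT (fun u => (fun i => marks U u (s i)) : config R m 1).
  apply: measurable_to_config => i l.
  exact: (measurableT_comp (measurable_coordinate (s i) l) mV).
have mD1 := measurable_sample mX mV mD.
have mD2 := measurable_sample mXs mV mD.
have mD3 := measurable_sample mXs mVs mD.
have -> : (P \x PU)%E [set w | D (Xs w.1, (fun i => marks U w.2 (s i)))] =
    (P \x PU)%E [set w | D (Xs w.1, marks U w.2)].
  apply: eq_integral => w _ /=.
  have mDw : measurable [set v | D (Xs w, v)].
    by have := measurable_xsection (Xs w) mD; rewrite /xsection; under eq_set do rewrite inE.
  have := marks_exchangeable iidU s mDw.
  by rewrite /xsection; congr (PU _ = PU _); apply/seteqP; split=> u /=; rewrite inE.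
have fubini E : measurable E -> (P \x PU)%E E = (P \x^ PU)%E E.
  move=> mE; apply: product_measure_unique => //= A B mA mB.
  by rewrite product_measure2E.
rewrite !fubini//.
apply: (@le_trans _ _ (\int[PU]_u
  (P (ysection [set w | D (Xs w.1, marks U w.2)] u) + e%:E))%E).
  apply: ge0_le_integral => //.
  - exact: measurable_fun_ysection.
  - apply: emeasurable_funD; last exact: measurable_cst.
    exact: measurable_fun_ysection.
  - move=> u _ /=.
    have ysectionE (Y : Omega -> config R m d) :
        ysection [set w : Omega * TU | D (Y w.1, marks U w.2)] u =
        [set w | (ysection D (marks U u)) (Y w)].
      by apply/seteqP; split=> w; rewrite /ysection /= !inE.
    rewrite !ysectionE; apply: nearly; exact: measurable_ysection.
rewrite ge0_integralD//; last exact: measurable_fun_ysection.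
by rewrite leeD2l// integral_cst// -[X in (_ * X)%E]/(PU setT) probability_setT mule1.
Qed.

End swap_bound.

(** * The distance of the shuffle from uniformity *)

Section shuffle.
Context (R : realType) (d : nat) (discrete : bool).
Context (Q : forall m, R.-pker (config R m d) ~> (path_space R m d)).
Context (Z : forall m (z : config R m d), process discrete (Q m) z).
Hypothesis Q_exchangeable : exchangeable Q.
Context (dU : measure_display) (TU : measurableType dU).
Context (PU : probability TU R) (U : nat -> {RV PU >-> R}).
Hypothesis iidU : iid_uniform U.
Context (k : 'I_d) (m : nat) (z : config R m d) (t e : R).
Hypothesis t_ge0 : 0 <= t.
Hypothesis e_ge0 : 0 <= e.
Hypothesis meet_before_t : forall i j : 'I_m, i != j ->
  (prob (Z z) [set w | t%:E < meeting_time (Z z) i j w] <= e%:E)%E.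

Local Notation Omega := (Defs.space (Z z)).

Let X (w : Omega) : config R m d := traj t w.

Let mX : measurable_fun setT X.
Proof. exact: measurable_state. Qed.

(** The exchange of i and j is free on the event that they have met by time t. *)
Lemma state_nearly_swapped (i j : 'I_m) (B : set (config R m d)) : i != j ->
  measurable B ->
  (prob (Z z) [set w | B (X w)] <=
   prob (Z z) [set w | B (fun l => X w (tperm i j l))] + e%:E)%E.
Proof.
move=> ij mB; pose P := prob (Z z).
pose E := [set w | (meeting_time (Z z) i j w <= t%:E)%E].
have mE : measurable E.
  apply: (filt_measurable t_ge0).
  by have [_] := meeting_time_optional (Z z) i j; exact.
have mEC : measurable [set w | (t%:E < meeting_time (Z z) i j w)%E].
  by apply: (filt_measurable t_ge0); exact: meeting_time_measurable.
have mBX : measurable [set w | B (X w)].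
  by have := mX measurableT mB; rewrite setTI.
have mBXs : measurable [set w | B (fun l => X w (tperm i j l))].
  have mXs : measurable_fun setT
      (fun w => (fun l => X w (tperm i j l)) : config R m d).
    apply: measurable_to_config => l a.
    exact: (measurableT_comp (measurable_coordinate (tperm i j l) a) mX).
  by have := mXs measurableT _ mB; rewrite setTI.
apply: (@le_trans _ _ (P (E `&` [set w | B (X w)]) +
    P [set w | (t%:E < meeting_time (Z z) i j w)%E])%E).
  apply: le_trans (measureU2 P (measurableI _ _ mE mBX) mEC).
  apply: le_measure; rewrite ?inE//.
    by apply: measurableU => //; exact: measurableI.
  move=> w BXw; have [tau_t|tau_t] := leP (meeting_time (Z z) i j w) t%:E.
    by left.
  by right.
apply: leeD; last exact: meet_before_t.
rewrite [leLHS](@swap_after_meeting R m d discrete (Q m) z (Z z) i j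
  (fun x A => @Q_exchangeable m x (tperm i j) A) t B t_ge0 mB).
by apply: le_measure; rewrite ?inE//; exact: measurableI.
Qed.

Local Notation Pi := (prob (Z z) \x PU)%E.

Let ranked (w : Omega * TU) (g : 'S_m) : Prop :=
  rank_to_index (fun i => X w.1 i ord0 k) (fun i => U i w.2) g.

Let rankedE g : [set w | ranked w g] =
  [set w : Omega * TU | rank_event k g (X w.1, marks U w.2)].
Proof.
have marksE u : (fun i : 'I_m => marks U u i ord0 ord0) = (fun i => U i u).
  by apply/funext => i; rewrite mxE.
by apply/seteqP; split=> w; rewrite /ranked /rank_event /= marksE.
Qed.

Let measurable_ranked (A : {set 'S_m}) :
  measurable [set w | exists2 g, g \in A & ranked w g].
Proof.
rewrite (_ : [set w | _] = \bigcup_(g in [set` A]) [set w | ranked w g]).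
  apply: fin_bigcup_measurable => [|g _]; first exact: finite_finset.
  rewrite rankedE; apply: measurable_sample => //; first exact: measurable_marks.
  exact: measurable_rank_event.
by [].
Qed.

Let Pi_setT : Pi setT = 1%E.
Proof.
rewrite -setXTT product_measure1E//.
by rewrite [X in (X * _)%E]probability_setT [X in (_ * X)%E]probability_setT mule1.
Qed.

Let Pi_fin E : measurable E -> Pi E \is a fin_num.
Proof.
move=> mE; rewrite ge0_fin_numE//; apply: (@le_lt_trans _ _ 1%E); last exact: ltry.
by rewrite -Pi_setT; apply: le_measure; rewrite ?inE.
Qed.

Let shuffle_additive (A : {set 'S_m}) :
  shuffle_law Z U k z t A = (\sum_(g in A) Pi [set w | ranked w g])%E.
Proof.
have mg g : measurable [set w | ranked w g].
  have := measurable_ranked [set g]%SET; congr measurable.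
  apply/seteqP; split=> w /=; first by case=> h; rewrite inE => /eqP ->.
  by exists g; rewrite // inE.
have ms (s : seq 'S_m) : measurable [set w | exists2 g, g \in s & ranked w g].
  have := measurable_ranked [set g in s]%SET; congr measurable.
  by apply/seteqP; split=> w /= [g gs gr]; exists g; rewrite ?inE// in gs *.
have seqE (s : seq 'S_m) : uniq s ->
    Pi [set w | exists2 g, g \in s & ranked w g] =
    (\sum_(g <- s) Pi [set w | ranked w g])%E.
  elim: s => [_|g s IH /= /andP[gs us]].
    rewrite big_nil (_ : [set w | _] = set0) ?measure0//.
    by rewrite -subset0 => w [].
  rewrite big_cons -IH// -measureU//.
    congr Pi; apply/seteqP; split=> w /=.
      move=> [h]; rewrite inE => /orP[/eqP ->|hs hr]; first by left.
      by right; exists h.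
    move=> [gr|[h hs hr]]; first by exists g; rewrite // mem_head.
    by exists h; rewrite // inE hs orbT.
  rewrite -subset0 => w /= [gr [h hs hr]].
  by move: gs; rewrite (rank_unique gr hr) hs.
rewrite -big_enum /= -seqE ?enum_uniq//.
by congr Pi; apply/seteqP; split=> w /= [g gA gr]; exists g;
  rewrite ?mem_enum// in gA *.
Qed.

(** Almost surely there are no ties between the tie-breaking variables. *)
Let shuffle_total : shuffle_law Z U k z t [set: 'S_m]%SET = 1%E.
Proof.
pose N (a b : nat) := if a != b then [set u | U a u = U b u] else set0.
have mUU a b : measurable [set u | U a u = U b u].
  have := @measurable_fun_eqr _ TU R setT (U a) (U b) (measurable_funPT _)
    (measurable_funPT _) measurableT [set true] Logic.I.
  rewrite setTI (_ : _ @^-1` _ = [set u | U a u = U b u])//.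
  by apply/seteqP; split=> u /= /eqP.
have : PU.-negligible (\bigcup_a \bigcup_b N a b).
  apply: negligible_bigcup => a; apply: negligible_bigcup => b; rewrite /N.
  case: ifP => [ab|_]; last exact: negligible_set0.
  by apply/negligibleP => //; exact: marks_distinct.
move=> [N0 [mN0 PN0 NN0]].
have mA := measurable_ranked [set: 'S_m]%SET.
apply/eqP; rewrite eq_le; apply/andP; split.
  by rewrite -Pi_setT; apply: le_measure; rewrite ?inE.
rewrite -Pi_setT -[leRHS]adde0.
have PiN : Pi (setT `*` N0) = 0%E by rewrite product_measure1E// [X in (_ * X)%E]PN0 mule0.
rewrite -PiN; apply: le_trans (measureU2 Pi mA (measurableX measurableT mN0)).
apply: le_measure; rewrite ?inE//.
  by apply: measurableU => //; exact: measurableX.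
move=> [w u] _; have [Nu|Nu] := pselect (N0 u); [by right|left].
have U_inj : injective (fun i : 'I_m => U i u).
  move=> a b Uab; apply/eqP/negPn/negP => ab; apply: Nu; apply: NN0.
  by exists a => //; exists b => //; rewrite /N val_eqE ab.
have [g gr] := rank_exists (fun i => X w i ord0 k) U_inj.
by exists g; rewrite // inE.
Qed.

Let shuffle_tperm (A : {set 'S_m}) (i j : 'I_m) : i != j ->
  (shuffle_law Z U k z t A <= shuffle_law Z U k z t (A :* tperm i j)%g + e%:E)%E.
Proof.
move=> ij; pose D := \bigcup_(g in [set` A]) @rank_event R m d k g.
have mD : measurable D.
  apply: fin_bigcup_measurable => [|g _]; first exact: finite_finset.
  exact: measurable_rank_event.
have DE w : D (X w.1, marks U w.2) <-> exists2 g, g \in A & ranked w g.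
  by split=> -[g gA gr]; exists g => //; move: gr;
    rewrite -[ranked w g]/([set w | ranked w g] w) rankedE.
have := @swap_bound R m d (tperm i j) _ _ Omega TU (prob (Z z)) PU U X e
  iidU mX e_ge0 (fun B mB => state_nearly_swapped ij mB) D mD.
rewrite (_ : [set w | D (X w.1, _)] = [set w | exists2 g, g \in A & ranked w g]);
  last by apply/seteqP; split=> w /= /DE.
rewrite (_ : [set w | D _] =
    [set w | exists2 g, g \in (A :* tperm i j)%g & ranked w g]) //.
have perm_ranked w g :
    rank_event k g ((fun l => X w.1 (tperm i j l)), (fun l => marks U w.2 (tperm i j l)))
    <-> ranked w (g * tperm i j)%g.
  rewrite -[ranked w _]/([set w | ranked w (g * tperm i j)%g] w) rankedE.
  exact: (rank_to_index_perm (fun l => X w.1 l ord0 k)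
    (fun l => (marks U w.2 : config R m 1) l ord0 ord0)).
apply/seteqP; split=> w /=.
  move=> [g gA /perm_ranked gr]; exists (g * tperm i j)%g => //.
  by rewrite mem_rcoset mulgK.
move=> [h /rcosetP [g gA ->] gr]; exists g => //.
exact/perm_ranked.
Qed.

Lemma shuffle_tv_le : (shuffle_tv Z U k z t <= (m%:R * e)%:E)%E.
Proof.
pose q g := fine (Pi [set w | ranked w g]).
pose p A := fine (shuffle_law Z U k z t A).
have lawE A : shuffle_law Z U k z t A = (p A)%:E.
  by rewrite /p fineK//; exact: (Pi_fin (measurable_ranked A)).
have qE g : Pi [set w | ranked w g] = (q g)%:E.
  rewrite /q fineK//; apply: Pi_fin; have := measurable_ranked [set g]%SET.
  congr measurable; apply/seteqP; split=> w /=.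
    by case=> h; rewrite inE => /eqP ->.
  by exists g; rewrite // inE.
have p_additive A : p A = \sum_(g in A) q g.
  by apply: EFin_inj; rewrite -lawE shuffle_additive -sumEFin; apply: eq_bigr.
apply: bigmax_le => [|A _]; first by rewrite lee_fin mulr_ge0.
rewrite lawE -EFinB abse_EFin lee_fin.
rewrite (_ : #|[set: 'S_m]| = #|{: 'S_m}|); last first.
  by apply: eq_card => g; transitivity true; [exact: mem_setT|].
apply: (nearly_uniform p_additive) => //.
  apply: EFin_inj; rewrite -shuffle_total lawE p_additive; congr EFin.
  by apply: eq_bigl => g; rewrite inE.
by move=> B i j ij; rewrite -lee_fin EFinD -!lawE; exact: shuffle_tperm.
Qed.

End shuffle.

Lemma t_mix_le (R : realType) (d : nat) (discrete : bool)
    (Q : forall m, R.-pker (config R m d) ~> (path_space R m d))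
    (Z : forall m (z : config R m d), process discrete (Q m) z)
    (dU : measure_display) (TU : measurableType dU) (PU : probability TU R)
    (U : nat -> {RV PU >-> R}) (k : 'I_d) (m : nat) (eps t e : R) :
  exchangeable Q -> iid_uniform U -> 0 <= t -> 0 <= e -> m%:R * e < eps ->
  (forall (z : config R m d) (i j : 'I_m), i != j ->
    (prob (Z m z) [set w | t%:E < meeting_time (Z m z) i j w] <= e%:E)%E) ->
  (t_mix Z U k m eps <= t%:E)%E.
Proof.
move=> Q_exch iidU t0 e0 me tail; apply: ereal_inf_lbound; exists t => //.
split=> // z.
have h := shuffle_tv_le Q_exch iidU k t0 e0 (tail z).
by apply: le_lt_trans h _; rewrite lte_fin.
Qed.

Theorem theorem2 (R : realType) (d : nat) (d_gt0 : (0 < d)%N)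
    (discrete : bool)
    (Q : forall m, R.-pker (config R m d) ~> (path_space R m d))
    (Z : forall m (z : config R m d), process discrete (Q m) z)
    (Q_consistent : dimension_consistent Q)
    (dzeta : measure_display) (Tzeta : measurableType dzeta)
    (Pzeta : probability Tzeta R) (zeta : {RV Pzeta >-> R})
    (zeta_gt0 : forall w, 0 < zeta w)
    (meeting_dominated : forall x y : 'rV[R]_d,
      let Zxy := Z 2%N (pair_config x y) in
      stochastically_dominated (prob Zxy) (meeting_time Zxy ord0 ord_max)
        Pzeta (fun w => (zeta w)%:E)) :
  let time_unit (M : R) :=
    0 < M /\ (Pzeta [set w | (M < zeta w)%R] <= (2^-1)%:E)%E in
  let density_at_0 (alpha : R) :=
    (alpha%:E <= limf_einf
       (fun u : R => (u^-1)%:E * Pzeta [set w | (zeta w <= u)%R]) 0^'+)%E in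
  [/\ (exists M : R, time_unit M) /\
      exists2 C : R, 0 < C &
        forall M : R, time_unit M ->
        forall m (z : config R m d) (i j : 'I_m), i != j ->
        forall t : R, 0 <= t ->
          (prob (Z m z) [set w | t%:E < meeting_time (Z m z) i j w]
             <= (C * 2 `^ (- (t / M)))%:E)%E,
      forall alpha : R, 0 < alpha -> density_at_0 alpha ->
        forall m (z : config R m d) (i j : 'I_m), i != j ->
          stochastically_dominated
            (prob (Z m z)) (meeting_time (Z m z) i j)
            (exponential_prob alpha) (fun x : R => x%:E) &
      exchangeable Q ->
      forall (dU : measure_display) (TU : measurableType dU)
        (PU : probability TU R) (U : nat -> {RV PU >-> R}), iid_uniform U ->
      forall k : 'I_d,
        (forall eps : R, 0 < eps ->
           exists C : R, \forall m \near \oo,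
             (t_mix Z U k m eps <= (C * ln m%:R)%:E)%E) /\
        (forall alpha : R, 0 < alpha -> density_at_0 alpha ->
           forall m (eps : R), (0 < m)%N -> 0 < eps -> eps <= m%:R ->
             (t_mix Z U k m eps <= (alpha^-1 * ln (m%:R / eps))%:E)%E) ].
Proof.
move=> time_unit density_at_0.
have tail_of u c : (Pzeta [set w | (u < zeta w)%R] <= c%:E)%E -> pair_tail_le Z u c.
  by move=> h x y; apply: le_trans h; exact: meeting_dominated.
have unit_exists : exists M, time_unit M by apply: small_tail; rewrite invr_gt0.
have rate_tail alpha : 0 < alpha -> density_at_0 alpha ->
    forall m (z : config R m d) (i j : 'I_m), i != j -> forall t : R, 0 <= t ->
    (prob (Z m z) [set w | t%:E < meeting_time (Z m z) i j w] <=
     (expR (- alpha * t))%:E)%E.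
  move=> alpha0 dens; apply: (tail_rate d_gt0 Q_consistent alpha0) => a aalpha.
  have [r r0 rP] := density_at_0_tail aalpha dens.
  by exists r => // u u0 ur; apply: tail_of; exact: rP.
split.
- split=> //; exists 2 => // M [M0 hM] m z i j ij t t0.
  exact: (tail_half d_gt0 Q_consistent M0 (tail_of _ _ hM)).
- move=> alpha alpha0 dens m z i j ij t; have [t0|t0] := leP 0 t.
    by rewrite exponential_prob_tail//; exact: rate_tail.
  (* For t < 0 the left side is 1, which the right side already attains at 0. *)
  rewrite (_ : [set w | _] = setT); last first.
    rewrite -subTset => w _ /=; rewrite meeting_timeE.
    by apply: (lt_le_trans _ (first_zero_ge0 _)); rewrite lte_fin.
  rewrite [leLHS]probability_setT.
  have := @exponential_prob_tail R alpha 0 alpha0 (lexx 0).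
  rewrite mulr0 expR0 => <-; rewrite /exponential_prob.
  apply: ge0_subset_integral => //=.
  - rewrite (_ : [set x | _] = `]0, +oo[%classic); first exact: measurable_itv.
    by apply/seteqP; split=> x /=; rewrite lte_fin in_itv/= andbT.
  - rewrite (_ : [set x | _] = `]t, +oo[%classic); first exact: measurable_itv.
    by apply/seteqP; split=> x /=; rewrite lte_fin in_itv/= andbT.
  - by apply/measurable_EFinP/measurable_funTS; exact: measurable_exponential_pdf.
  - by move=> x _; rewrite lee_fin exponential_pdf_ge0// ltW.
  - by move=> x /=; rewrite !lte_fin; exact: lt_trans.
- move=> Q_exch dU TU PU U iidU k; split=> [eps eps0|alpha alpha0 dens m eps m0 eps0 epsm].
    have [M uM] := unit_exists; have [M0 hM] := uM.
    (* At time 2 M log_2 m the tails are at most 2 / m^2, and m times this tends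
       to 0. *)
    exists (2 * M / ln 2); near=> m.
    have m2 : (1 < m)%N by near: m; exact: nbhs_infty_gt.
    have m_gt0 : 0 < m%:R :> R by rewrite ltr0n ltnW.
    have ln2 : 0 < ln 2 :> R by rewrite ln_gt0// ltr1n.
    have t0 : 0 <= 2 * M / ln 2 * ln m%:R.
      by rewrite mulr_ge0// ?divr_ge0 ?mulr_ge0 ?ltW// ln_gt0// ltr1n.
    pose e : R := 2 * (m%:R ^+ 2)^-1.
    have e0 : 0 <= e by rewrite /e mulr_ge0// invr_ge0 exprn_ge0// ltW.
    apply: (@t_mix_le R d discrete Q Z dU TU PU U k m eps _ e Q_exch iidU t0 e0).
      have m_large : 2 / eps < m%:R by near: m; exact: nbhs_infty_gtr.
      rewrite (_ : m%:R * e = 2 / m%:R); last by rewrite /e; field; rewrite gt_eqF.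
      by rewrite ltr_pdivrMr// mulrC -ltr_pdivrMr.
    move=> z i j ij.
    apply: le_trans (tail_half d_gt0 Q_consistent M0 (tail_of _ _ hM) z ij t0) _.
    rewrite lee_fin /e ler_pM2l// /powR pnatr_eq0 /=.
    rewrite (_ : _ * ln 2 = - (2%:R * ln m%:R)); last first.
      by field; rewrite !gt_eqF.
    by rewrite expRN expRM_natl lnK// posrE.
  (* At the time claimed the distance is at most eps; strict inequality requires
     a little more time. *)
  apply/lee_addgt0Pr => e e0; rewrite -EFinD.
  have m_gt0 : 0 < m%:R :> R by rewrite ltr0n.
  have t0 : 0 <= alpha^-1 * ln (m%:R / eps) + e.
    rewrite addr_ge0 ?(ltW e0)// mulr_ge0 ?invr_ge0 ?(ltW alpha0)//.
    by rewrite ln_ge0// ler_pdivlMr// mul1r.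
  apply: (@t_mix_le R d discrete Q Z dU TU PU U k m eps _
    (expR (- alpha * (alpha^-1 * ln (m%:R / eps) + e))) Q_exch iidU t0 (expR_ge0 _)).
    rewrite (_ : - alpha * _ = - ln (m%:R / eps) + - alpha * e); last first.
      by field; rewrite gt_eqF.
    rewrite expRD expRN lnK; last by rewrite posrE divr_gt0.
    rewrite (_ : _ * _ = eps * expR (- alpha * e)); last first.
      by field; rewrite !gt_eqF.
    by rewrite gtr_pMr// expR_lt1 mulNr oppr_lt0 mulr_gt0.
  by move=> z i j ij; exact: rate_tail.
Unshelve. all: end_near.
Qed.
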